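(* For each $n\ge1$ let $r_n\ge 1$ and let $K_n^{(1)},\dots,K_n^{(r_n)}\in[1,n]$ be integers with $\sum_{j=1}^{r_n}K_n^{(j)}=n$, and let $\mathcal{T}_n=\min\{T^{(1)},\dots,T^{(r_n)}\}$ be the minimum of the corresponding disjoint-cylinder passage times (as defined in the context). Suppose that $$n^{-1/2}\sum_{j=1}^{r_n}\left(K_n^{(j)}\right)^{-1/2}\to0\quad\text{as }n\to\infty.$$ Then $(\mathcal{T}_n)$ has fluctuations of at least order $$\min_{j=1,\dots,r_n}\sqrt{\frac{n}{K_n^{(j)}(1+\log r_n)}}.$$
   Context: Let $(t_e)$ be i.i.d. exponential random variables with mean $1$ indexed by the nearest-neighbor edges of $\mathbb{Z}^2$; for a nearest-neighbor path $\Gamma$ put $T(\Gamma)=\sum_{e\in\Gamma}t_e$. Define cylinders $\mathsf{C}^{(1)}=[0,n]\times[0,K_n^{(1)}-1]$ and, for $j=2,\dots,r_n$, $$\mathsf{C}^{(j)}=[0,n]\times[K_n^{(1)}+\dots+K_n^{(j-1)},\,K_n^{(1)}+\dots+K_n^{(j)}-1].$$ $T^{(j)}$ is the infimum of $T(\Gamma)$ over all paths $\Gamma$ with all vertices in $\mathsf{C}^{(j)}\cap\mathbb{Z}^2$ connecting the left side (vertices with first coordinate $0$) to the right side (vertices with first coordinate $n$) of $\mathsf{C}^{(j)}$. A sequence of real random variables $(X_n)$ has fluctuations of at least order $f(n)$ if there exist reals $a_n,b_n$ and a number $c>0$ such that for all large $n$: $b_n-a_n\ge cf(n)$, $\mathbf{P}(X_n\le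 a_n)>c$, and $\mathbf{P}(X_n\ge b_n)>c$. *)

(* Defs.v *)
From HB Require Import structures.
From mathcomp Require Import all_boot all_order all_algebra.
From mathcomp Require Import all_classical all_reals all_analysis measurable_realfun.
Set Implicit Arguments.
Unset Strict Implicit.
Unset Printing Implicit Defensive.
Import Order.TTheory GRing.Theory Num.Theory.
Import numFieldNormedType.Exports.
Local Open Scope classical_set_scope.
Local Open Scope ring_scope.

Definition mutually_independent d (T : measurableType d) (R : realType)
    (P : probability T R) (I : eqType) (X : I -> {RV P >-> R}) : Prop :=
  forall (s : seq I) (B : I -> set R), uniq s ->
    (forall i, measurable (B i)) ->
    P (\big[setI/setT]_(i <- s) (X i @^-1` B i)) =
    (\prod_(i <- s) P (X i @^-1` B i))%E.

(* The exponential law with mean 1 is the one with rate 1. *)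
Definition iid_exponential_mean1 d (T : measurableType d) (R : realType)
    (P : probability T R) (I : eqType) (X : I -> {RV P >-> R}) : Prop :=
  (forall i (A : set R), measurable A ->
     distribution P (X i) A = exponential_prob 1 A) /\
  mutually_independent X.

Definition fluctuations_at_least d (T : measurableType d) (R : realType)
    (P : probability T R) (X : nat -> {RV P >-> R}) (f : nat -> R) : Prop :=
  exists (a b : nat -> R) (c : R), 0 < c /\
    \forall n \near \oo,
      [/\ c * f n <= b n - a n,
          (c%:E < P [set w | (X n w <= a n)%R])%E &
          (c%:E < P [set w | (b n <= X n w)%R])%E].

(* Minimum of F 1, ..., F r, for 1 <= r. *)
Definition min_upto (R : realType) (r : nat) (F : nat -> R) : R :=
  \big[Num.min/F 1%N]_(1 <= j < r.+1) F j.

Definition vertex : Type := (int * int)%type.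

Definition adjacent (x y : vertex) : bool :=
  `|x.1 - y.1| + `|x.2 - y.2| == 1.

(* The edge {v, v + e_1} is encoded as (v, false) and {v, v + e_2} as
   (v, true), so that each nearest-neighbor edge has exactly one code. *)
Definition edge : Type := (vertex * bool)%type.

(* Code of the unordered pair {x, y}, for adjacent x and y. *)
Definition edge_of (x y : vertex) : edge :=
  ((Num.min x.1 y.1, Num.min x.2 y.2), x.1 == y.1).

(* Edges of the path x :: s, each listed once even if the path repeats it.
   Nonnegative weights make this immaterial for infima over paths; counting
   once keeps those infima finite even on the null event of negative weights. *)
Definition path_edges (x : vertex) (s : seq vertex) : seq edge :=
  undup (pairmap edge_of x s).

Definition passage_time d (T : measurableType d) (R : realType)
    (P : probability T R) (t : edge -> {RV P >-> R})
    (x : vertex) (s : seq vertex) (w : T) : R :=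
  \sum_(e <- path_edges x s) t e w.

Definition in_cylinder (n : nat) (K : nat -> nat) (j : nat) (v : vertex) : bool :=
  (0 <= v.1 <= n%:Z) &&
  ((\sum_(1 <= i < j) K i)%N%:Z <= v.2 <= (\sum_(1 <= i < j.+1) K i)%N%:Z - 1).

Definition crossing (n : nat) (K : nat -> nat) (j : nat)
    (x : vertex) (s : seq vertex) : bool :=
  [&& path adjacent x s, all (in_cylinder n K j) (x :: s),
      x.1 == 0 & (last x s).1 == n%:Z].

Definition cylinder_time d (T : measurableType d) (R : realType)
    (P : probability T R) (t : edge -> {RV P >-> R})
    (n : nat) (K : nat -> nat) (j : nat) (w : T) : R :=
  inf [set passage_time t p.1 p.2 w | p in
        [set p : vertex * seq vertex | crossing n K j p.1 p.2]].

Definition min_cylinder_time d (T : measurableType d) (R : realType)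
    (P : probability T R) (t : edge -> {RV P >-> R})
    (n r : nat) (K : nat -> nat) (w : T) : R :=
  min_upto r (fun j => cylinder_time t n K j w).

Section measurability.
Context d (T : measurableType d) (R : realType) (P : probability T R).
Context (t : edge -> {RV P >-> R}) (n : nat) (K : nat -> nat).

Lemma measurable_passage_time x s :
  measurable_fun setT (passage_time t x s).
Proof. by apply: measurable_sum => e; exact: measurable_funPT. Qed.

Let box (j : nat) : seq edge :=
  [seq (v, b) | v <- [seq (a, c) | a <- map Posz (iota 0 n.+1),
                       c <- map Posz (iota 0 (\sum_(1 <= i < j.+1) K i))],
                b <- [:: true; false]].

Let mem_Posz_iota (z : int) m : (z \in map Posz (iota 0 m)) = (0 <= z < m%:Z).
Proof.
apply/mapP/idP => [[k km ->]|].
  by move: km; rewrite mem_iota.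
by case: z => // k /andP[_ km]; exists k => //; rewrite mem_iota.
Qed.

Let edge_in_box j x y : in_cylinder n K j x -> in_cylinder n K j y ->
  edge_of x y \in box j.
Proof.
move=> /andP[/andP[x10 x1n] /andP[x20 x2n]] /andP[/andP[y10 y1n] /andP[y20 y2n]].
apply: (@allpairs_f _ _ _ (@pair vertex bool)); last by case: (x.1 == y.1).
apply: (@allpairs_f _ _ _ (@pair int int)).
  by rewrite mem_Posz_iota le_min x10 y10/= gt_min intS ltz1D x1n.
rewrite mem_Posz_iota le_min gt_min (le_trans _ x20)// (le_trans _ y20)//=.
by rewrite (le_lt_trans x2n)// ltrBlDr ltrDl.
Qed.

Let path_edges_in_box j x s : all (in_cylinder n K j) (x :: s) ->
  {subset path_edges x s <= box j}.
Proof.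
move=> + e; rewrite mem_undup.
elim: s x => [//|y s ih] x /= /and3P[cx cy cs].
rewrite inE => /orP[/eqP ->|]; first exact: edge_in_box.
by apply: ih; rewrite /= cy.
Qed.

Let passage_time_ge j x s w : all (in_cylinder n K j) (x :: s) ->
  - (\sum_(e <- undup (box j)) `|t e w|) <= passage_time t x s w.
Proof.
move=> /path_edges_in_box sub.
have : `|passage_time t x s w| <= \sum_(e <- undup (box j)) `|t e w|.
  apply: (le_trans (ler_norm_sum _ _ _)).
  rewrite [leRHS](bigID (mem (path_edges x s)))/=.
  rewrite -[leLHS]addr0 lerD//; last first.
    exact: sumr_ge0.
  rewrite -[leRHS]big_filter [leRHS](perm_big (path_edges x s))//.
  apply: uniq_perm; rewrite ?filter_uniq ?undup_uniq// => e.
  rewrite mem_filter mem_undup [in RHS]mem_undup /= /path_edges mem_undup.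
  by case: (boolP (e \in pairmap _ _ _)) => //= ex; rewrite sub// mem_undup.
by rewrite ler_norml => /andP[].
Qed.

Lemma measurable_cylinder_time j :
  measurable_fun setT (cylinder_time t n K j).
Proof.
pose D : set (vertex * seq vertex) := [set p | crossing n K j p.1 p.2].
have [D0|/set0P D0] := eqVneq D set0.
  rewrite /cylinder_time -/D D0.
  rewrite (_ : (fun _ => _) = cst (inf set0)); first exact: measurable_cst.
  by apply/funext => w; rewrite image_set0.
apply: (measurability _ (RGenInftyO.measurableE R)).
move=> _ [_ [a ->] <-]; rewrite setTI.
pose F (p : vertex * seq vertex) := if crossing n K j p.1 p.2 then
  [set w | passage_time t p.1 p.2 w < a] else set0.
rewrite (_ : _ @^-1` _ = \bigcup_p F p).
  apply: countable_bigcupT_measurable => [|p]; first exact: countableP.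
  rewrite /F; case: ifP => // _; rewrite -preimage_itvNyo -[X in measurable X]setTI.
  exact: measurable_passage_time.
apply/seteqP; split => [w|w [p _]] /=.
  rewrite in_itv/= => /inf_lt[|_ [p pc <-] pa].
    by have [p Dp] := D0; exists (passage_time t p.1 p.2 w); exists p.
  by exists p => //; rewrite /F ifT.
rewrite /F; case: ifPn => // pc /= pa; rewrite in_itv/=.
apply: le_lt_trans pa; apply: ge_inf; last by exists p.
exists (- (\sum_(e <- undup (box j)) `|t e w|)) => _ [q qc <-].
by apply: passage_time_ge; case/and4P: qc.
Qed.

Lemma measurable_min_cylinder_time r :
  measurable_fun setT (min_cylinder_time t n r K).
Proof.
rewrite /min_cylinder_time /min_upto; elim: (index_iota _ _) => [|j s ih].
  under eq_fun do rewrite big_nil; exact: measurable_cylinder_time.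
under eq_fun do rewrite big_cons.
by apply: measurable_minr => //; exact: measurable_cylinder_time.
Qed.

HB.instance Definition _ j := isMeasurableFun.Build _ _ _ _
  (cylinder_time t n K j) (measurable_cylinder_time j).

HB.instance Definition _ r := isMeasurableFun.Build _ _ _ _
  (min_cylinder_time t n r K) (measurable_min_cylinder_time r).

End measurability.

(* Main.v *)
Require Import Defs.
From HB Require Import structures.
From mathcomp Require Import all_boot all_order all_algebra.
From mathcomp Require Import all_classical all_reals all_analysis measurable_realfun.
From mathcomp Require Import ring lra zify.
Set Implicit Arguments.
Unset Strict Implicit.
Unset Printing Implicit Defensive.
Import Order.TTheory GRing.Theory Num.Theory.
Import numFieldNormedType.Exports.
Local Open Scope classical_set_scope.
Local Open Scope ring_scope.

(* Multiplying the rates of the exponential weights in one cylinder of height K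
   by 1 + eps divides its passage time by 1 + eps, and the q-th moment of the
   likelihood ratio is at most exp(O(q^2 eps^2 n K)).  With q of order
   1 + log r and eps^2 of order 1 / (n K (1 + log r)), truncating the likelihood
   ratio at a constant level L shows that P(T_j <= x / (1 + eps)) is at least
   P(T_j <= x) / L up to an error of order 1 / r.  Summing over the r cylinders at
   the median x of the minimum, and using their independence, the minimum is
   below x / (1 + eps) with probability bounded away from 0.  A Peierls argument
   shows that x is at least of order n, so that x - x / (1 + eps) has order
   eps n. *)

(** * Densities *)

(** The order of the moment is forced by the number of cylinders. A union bound gives total
    probability at least 1/2 at the median, so each of the [r] truncation errors has to be about
    [1 / (8 r)]. A moment of bounded order would then require [L] to grow like a power of [r], and
    the factor [1 / L] would spoil the comparison. With order [N] just above [log r], the moment is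
    at most [exp (O(N))] and [r <= exp N], so a constant [L] has [L ^ N] larger than both together.
    The moments themselves are explicit, because a power of an exponential likelihood ratio is again
    a likelihood ratio up to a constant. What survives is a lower bound on the sum of the
    probabilities [a j] that single cylinders are fast. Independence is needed to turn it into a
    bound for the minimum, through [1 - \prod (1 - a j) >= 1 - exp (- \sum a j)]. The change of rate
    is realised as a rescaling map on configurations, so the argument runs on the space of functions
    from edges to reals, under the joint law of the weights. *)

Section density.
Context d (T : measurableType d) (R : realType) (mu : {measure set T -> \bar R}).
Variable g : T -> R.
Hypotheses (g0 : forall x, 0 <= g x) (mg : measurable_fun setT g).

Definition density (A : set T) : \bar R := (\int[mu]_(x in A) (g x)%:E)%E.

Let density0 : density set0 = 0%E.
Proof. by rewrite /density integral_set0. Qed.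

Let density_ge0 A : (0 <= density A)%E.
Proof. by apply: integral_ge0 => x _; rewrite lee_fin. Qed.

Let density_sigma_additive : semi_sigma_additive density.
Proof.
move=> F mF tF mUF; rewrite /density; apply: cvg_toP.
  apply: ereal_nondecreasing_is_cvgn => m n mn.
  by apply: lee_sum_nneg_natr => // k _ _; exact: density_ge0.
rewrite ge0_integral_bigcup//=.
- by apply/measurable_funTS; exact/measurable_EFinP.
- by move=> x _; rewrite lee_fin.
Qed.

HB.instance Definition _ := isMeasure.Build _ _ _
  density density0 density_ge0 density_sigma_additive.

Definition density_measure : {measure set T -> \bar R} := density.

End density.

Import HBNNSimple.

(** True for indicators by hypothesis, for simple functions by linearity, and in general by monotone
    convergence. [nu] need only agree with the density on measurable sets, so restrictions and image
    measures qualify. *)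
Lemma ge0_integral_density d (T : measurableType d) (R : realType)
    (mu nu : {measure set T -> \bar R}) (g : T -> R) (f : T -> \bar R) :
  (forall x, 0 <= g x) -> measurable_fun setT g ->
  (forall A, measurable A -> nu A = density mu g A) ->
  (forall x, 0 <= f x)%E -> measurable_fun setT f ->
  (\int[nu]_x f x = \int[mu]_x (f x * (g x)%:E))%E.
Proof.
move=> g0 mg nuE f0 mf.
pose h := nnsfun_approx measurableT mf.
have hf x : EFin \o (h ^~ x) @ \oo --> f x by apply: cvg_nnsfun_approx.
have hnd x : {homo (h ^~ x) : m n / (m <= n)%N >-> m <= n}.
  by move=> m n mn; exact/lefP/nd_nnsfun_approx.
transitivity (limn (fun n => \int[nu]_x (h n x)%:E)%E).
  rewrite -monotone_convergence//.
  - by apply: eq_integral => x _; apply/esym/cvg_lim => //; exact: hf.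
  - by move=> n; exact/measurable_EFinP/measurable_funP.
  - by move=> n x _; rewrite lee_fin.
  - by move=> x _ m n mn; rewrite lee_fin; exact: hnd.
transitivity (limn (fun n => \int[mu]_x ((h n x)%:E * (g x)%:E))%E); last first.
  rewrite -monotone_convergence//.
  - apply: eq_integral => x _; apply/cvg_lim => //.
    by apply: cvgeZr => //; exact: hf.
  - move=> n; apply: emeasurable_funM; apply/measurable_EFinP => //.
  - by move=> n x _; rewrite mule_ge0// lee_fin.
  - by move=> x _ m n mn; rewrite lee_pmul// ?lee_fin//; exact: hnd.
congr (limn _); apply/funext => n.
have mhE y : measurable_fun setT (fun x => (y * \1_(h n @^-1` [set y]) x)%:E).
  by apply/measurable_EFinP; exact: measurable_funM.
transitivity (\sum_(y \in range (h n))
    \int[nu]_x (y * \1_(h n @^-1` [set y]) x)%:E)%E.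
  under eq_integral do rewrite fimfunE -fsumEFin//.
  by rewrite ge0_integral_fsum// => y x _; rewrite nnfun_muleindic_ge0.
transitivity (\sum_(y \in range (h n))
    \int[mu]_x ((y * \1_(h n @^-1` [set y]) x)%:E * (g x)%:E))%E; last first.
  rewrite -ge0_integral_fsum//.
  - apply: eq_integral => x _; rewrite -ge0_mule_fsuml; last first.
      by move=> y; rewrite nnfun_muleindic_ge0.
    by rewrite fsumEFin// -fimfunE.
  - by move=> y; apply: emeasurable_funM => //; exact/measurable_EFinP.
  - by move=> y x _; rewrite mule_ge0 ?nnfun_muleindic_ge0// lee_fin.
apply: eq_fsbigr => y; rewrite inE => -[x0 _ yE].
have y0 : 0 <= y by rewrite -yE.
have mY : measurable (h n @^-1` [set y]) by exact: measurable_funPTI.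
under eq_integral do rewrite EFinM.
under [RHS]eq_integral do rewrite EFinM -muleA.
rewrite !ge0_integralZl//; last 3 first.
- by apply: emeasurable_funM; exact/measurable_EFinP.
- by move=> x _; rewrite mule_ge0// lee_fin.
- exact/measurable_EFinP.
congr (_ * _)%E; rewrite integral_indic// setIT nuE// /density.
rewrite integral_mkcond; apply: eq_integral => x _.
rewrite restrict_EFin/= patchE indicE; case: (_ \in _); by rewrite ?mul1e ?mul0e.
Qed.

(* The canonical instance is named because [pushforward mu f] alone does not
   determine the proof [mf] that it depends on. *)
Definition pushforward_measure d d' (T : measurableType d)
    (T' : measurableType d') (R : realType) (mu : {measure set T -> \bar R})
    (f : T -> T') (mf : measurable_fun setT f) : {measure set T' -> \bar R} :=
  measure_function_pushforward__canonical__measure_function_Measure mu mf.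

(** * The exponential law *)

Section exponential_law.
Variable R : realType.

(** Open rays generate the Borel sets and are stable under intersection, so these values determine
    the law. The maximum covers [x <= 0], where the second argument is nonpositive. *)
Lemma exponential_prob_itvNyo (c x : R) : 0 < c ->
  exponential_prob c `]-oo, x[ = (Num.max 0 (1 - expR (- c * x)))%:E.
Proof.
move=> c0; have mE : measurable_fun setT (EFin \o exponential_pdf c).
  by apply/measurable_EFinP; exact: measurable_exponential_pdf.
have [x0|x0] := leP x 0.
  rewrite /exponential_prob integral0_eq; last first.
    by move=> y /=; rewrite in_itv/= => yx;
    rewrite lt0_exponential_pdf// (lt_le_trans yx).
  by rewrite max_l// subr_le0 -expR0 ler_expR mulNr oppr_ge0 mulr_ge0_le0// ltW.
have -> : exponential_prob c `]-oo, x[ = exponential_prob c `[0, x].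
  rewrite /exponential_prob.
  rewrite (_ : `]-oo, x[%classic = `]-oo, 0[ `|` `[0, x[); last first.
    apply/seteqP; split => y /=; rewrite !in_itv/=.
      by move=> yx; case: (ltP y 0) => y0; [left|right].
    by move=> [y0|/andP[]//]; exact: lt_trans x0.
  rewrite ge0_integral_setU//=.
  - rewrite integral0_eq; last first.
      by move=> y /=; rewrite in_itv/= => y0; rewrite lt0_exponential_pdf.
    by rewrite add0e integral_itv_bndo_bndc//; exact: measurable_funTS.
  - exact: measurable_funTS.
  - by move=> y _; rewrite lee_fin exponential_pdf_ge0// ltW.
  - apply/disj_setPS => y /=; rewrite !in_itv/= => -[y0 /andP[]].
    by rewrite leNgt y0.
rewrite exponential_prob_itv0c// max_r// subr_ge0 -expR0 ler_expR mulNr oppr_le0.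
by rewrite mulr_ge0// ltW.
Qed.

(* [lebesgue_measure] lives on [measurableTypeR R], which differs from [R] in
   its display only; the identity transports the law to [R]. *)
Let id_measurableTypeR : measurable_fun setT (id : measurableTypeR R -> R).
Proof. by move=> _ A mA; rewrite setTI. Qed.

Let lebesgue_exponential (c : R) (c0 : 0 < c) :
    {measure set (measurableTypeR R) -> \bar R} :=
  density_measure lebesgue_measure
    (fun x => exponential_pdf_ge0 (ltW c0) x) (measurable_exponential_pdf c).

Definition exponential_law (c : R) (c0 : 0 < c) : {measure set R -> \bar R} :=
  pushforward_measure (lebesgue_exponential c0) id_measurableTypeR.

(** Both sides are measures in [B] that agree on the rays []-oo, x[], hence everywhere. *)
Lemma exponential_scale (c : R) (B : set R) : 0 < c -> measurable B ->
  exponential_prob 1 ((fun x => x / c) @^-1` B) = exponential_prob c B.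
Proof.
move=> c0 mB.
have mc : measurable_fun setT (fun x : R => x / c) by exact: measurable_funM.
pose m1 := pushforward_measure (exponential_law ltr01) mc.
pose m2 := exponential_law c0.
have m1E x : m1 `]-oo, x[%classic = exponential_prob 1 `]-oo, c * x[%classic.
  rewrite /m1 /= /pushforward/=; congr (exponential_prob 1 _).
  by apply/seteqP; split => y /=; rewrite !in_itv/= ltr_pdivrMr// mulrC.
have -> : exponential_prob 1 ((fun x => x / c) @^-1` B) = m1 B by [].
have -> : exponential_prob c B = m2 B by [].
apply: (measure_unique [set `]-oo, x[%classic | x in [set: R]]
  (fun n => `]-oo, n%:R[%classic)) => //.
- rewrite (_ : [set _ | _ in _] = @RGenInftyO.G R); last first.
    by apply/seteqP; split => [_ [x _ <-]|_ [x ->]]; exists x.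
  exact: RGenInftyO.measurableE.
- move=> _ _ [x _ <-] [y _ <-]; exists (Num.min x y) => //.
  by apply/seteqP; split => z /=; rewrite !in_itv/= lt_min => /andP.
- apply/seteqP; split => // x _; exists (Num.truncn x).+1 => //=.
  by rewrite in_itv/= truncnS_gt.
- move=> _ [x _ <-]; rewrite m1E exponential_prob_itvNyo//.
  have -> : m2 `]-oo, x[%classic = exponential_prob c `]-oo, x[%classic by [].
  by rewrite exponential_prob_itvNyo// mulN1r mulNr.
- by move=> n; rewrite m1E exponential_prob_itvNyo// ltry.
Qed.

(** The integrand is the quotient of the densities of rates [c] and 1 on the half-line where they
    are positive. *)
Lemma exponential_tilt (c : R) (B : set R) : 0 < c -> measurable B ->
  (\int[exponential_law ltr01]_(x in B) (c * expR (- (c - 1) * x))%:E =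
   exponential_prob c B)%E.
Proof.
move=> c0 mB; rewrite integral_mkcond.
have cE0 x : (0 <= ((fun x => (c * expR (- (c - 1) * x))%:E) \_ B) x)%E.
  rewrite patchE; case: ifPn => // _.
  by rewrite lee_fin mulr_ge0 ?expR_ge0// ltW.
have m1 : measurable_fun setT (fun x : R => c * expR (- (c - 1) * x)).
  apply: measurable_funM => //.
  by apply: (measurableT_comp (@measurable_expR R)); exact: measurable_funM.
have mcE : measurable_fun setT ((fun x => (c * expR (- (c - 1) * x))%:E) \_ B).
  by apply/(measurable_restrictT _ mB); apply: measurable_funTS; exact/measurable_EFinP.
rewrite ge0_integral_pushforward// preimage_setT.
rewrite (ge0_integral_density (mu := lebesgue_measure)
  (fun x => exponential_pdf_ge0 ler01 x)
   (measurable_exponential_pdf 1))//.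
- rewrite [RHS]integral_mkcond; apply: eq_integral => x _.
  rewrite /= !patchE; case: ifPn => // _; last by rewrite mul0e.
  have [x0|x0] := leP 0 x; last by rewrite !lt0_exponential_pdf// mule0.
  rewrite !exponential_pdfE// -EFinM mul1r -mulrA -expRD.
  by congr (c * expR _)%:E; ring.
Qed.

Lemma exponential_probT (c : R) : 0 < c -> exponential_prob c [set: R] = 1%E.
Proof. exact: integral_exponential_pdf. Qed.

Lemma exponential_prob_lt0 : exponential_prob 1 `]-oo, (0 : R)[%classic = 0%E.
Proof. by rewrite exponential_prob_itvNyo// mulr0 expR0 subrr maxxx. Qed.

End exponential_law.

(** * Product of exponential laws *)

Section coordinate_space.
Variables (I : choiceType) (R : realType).

Definition rect (B : I -> set R) : set (I -> R) := [set f | forall i, B i (f i)].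

Definition finite_rect : set (set (I -> R)) :=
  [set C | exists (s : seq I) (B : I -> set R),
    [/\ forall i, measurable (B i), forall i, i \notin s -> B i = setT &
        C = rect B]].

(** The product sigma-algebra. Its generators constrain finitely many coordinates and form a
    pi-system, so finite-dimensional marginals determine a probability on it. *)
Definition coord_space := g_sigma_algebraType finite_rect.

Lemma rectI (B B' : I -> set R) :
  rect B `&` rect B' = rect (fun i => B i `&` B' i).
Proof.
apply/seteqP; split => f.
  by move=> [Bf B'f] i; split; [exact: Bf|exact: B'f].
by move=> BB'f; split => i; have [] := BB'f i.
Qed.

Lemma rectT : rect (fun=> setT) = setT.
Proof. by apply/seteqP; split. Qed.

Lemma finite_rectT : finite_rect setT.
Proof. by exists [::], (fun=> setT); split => //; rewrite rectT. Qed.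

Lemma measurable_rect (s : seq I) (B : I -> set R) :
  (forall i, measurable (B i)) -> (forall i, i \notin s -> B i = setT) ->
  measurable (rect B : set coord_space).
Proof. by move=> mB sB; apply: sub_sigma_algebra; exists s, B. Qed.

Lemma finite_rectI : setI_closed finite_rect.
Proof.
move=> _ _ [s [B [mB sB ->]]] [s' [B' [mB' sB' ->]]].
exists (s ++ s'), (fun i => B i `&` B' i); split; last by rewrite rectI.
  by move=> i; exact: measurableI.
by move=> i; rewrite mem_cat negb_or => /andP[/sB -> /sB' ->]; rewrite setIT.
Qed.

Lemma coord_space_measure_unique (m1 m2 : {measure set coord_space -> \bar R}) :
  (m1 setT < +oo)%E -> (forall A, finite_rect A -> m1 A = m2 A) ->
  forall A, measurable A -> m1 A = m2 A.
Proof.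
move=> m1oo m12 A mA;
  apply: (@measure_unique _ R coord_space finite_rect (fun=> setT)) => //.
- exact: finite_rectI.
- by move=> _; exact: finite_rectT.
- by rewrite bigcup_const.
Qed.

Lemma measurable_to_coord_space d (T : measurableType d) (phi : T -> coord_space) :
  (forall i, measurable_fun setT (fun x => phi x i)) -> measurable_fun setT phi.
Proof.
move=> mphi; apply: (@measurability _ _ T coord_space setT phi finite_rect) => //.
move=> _ [_ [s [B [mB sB ->]]] <-]; rewrite setTI.
rewrite (_ : _ @^-1` _ =
    \bigcap_(i in [set` s]) ((fun x => phi x i) @^-1` B i)); last first.
  apply/seteqP; split => [x Bx i _|x Bx i]; first exact: Bx.
  by have [/Bx//|/sB ->] := boolP (i \in s).
rewrite bigcap_seq; apply: bigsetI_measurable => i _.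
by rewrite -[X in measurable X]setTI; exact: mphi.
Qed.

Definition coordinate (i : I) (f : coord_space) : R := f i.

Lemma measurable_coordinate i : measurable_fun setT (coordinate i).
Proof.
move=> _ A mA; rewrite setTI.
rewrite (_ : _ @^-1` _ = rect (fun j => if j == i then A else setT)).
  apply: (@measurable_rect [:: i]); first by move=> j; case: ifP.
  by move=> j; rewrite inE => /negPf ->.
apply/seteqP; split => f /=; last by move/(_ i); rewrite eqxx.
by move=> Af j; case: eqP => [->|].
Qed.

HB.instance Definition _ i := isMeasurableFun.Build _ _ _ _
  (coordinate i) (measurable_coordinate i).

(** Only finitely many coordinates move, which is what makes the image law absolutely continuous,
    with a finite product of one-dimensional densities. *)
Definition scale_coords (s : seq I) (c : R) (f : coord_space) : coord_space :=
  fun i => if i \in s then f i / c else f i.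

Lemma measurable_scale_coords s c : measurable_fun setT (scale_coords s c).
Proof.
apply: measurable_to_coord_space => i; rewrite /scale_coords.
case: (i \in s); last exact: measurable_coordinate.
by apply: measurable_funM => //; exact: measurable_coordinate.
Qed.

Definition depends_on (D : pred I) (A : set coord_space) :=
  forall f g, {in D, f =1 g} -> A f -> A g.

(** Characterizes the product of mean 1 exponential laws by its values on rectangles. As a
    hypothesis on a given measure it spares the construction of an infinite product. *)
Definition exponential_product (m : set coord_space -> \bar R) :=
  forall (s : seq I) (B : I -> set R), uniq s ->
  (forall i, measurable (B i)) -> (forall i, i \notin s -> B i = setT) ->
  m (rect B) = (\prod_(i <- s) exponential_prob 1 (B i))%E.

Variable mu : probability coord_space R.
Hypothesis mu_rect : exponential_product mu.

(** The likelihood ratio of the exponential law of rate [c] against that of rate 1. *)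
Definition tilt (c x : R) := c * expR (- (c - 1) * x).

Lemma tilt_ge0 c x : 0 <= c -> 0 <= tilt c x.
Proof. by move=> c0; rewrite mulr_ge0// expR_ge0. Qed.

Lemma measurable_tilt c : measurable_fun setT (tilt c).
Proof.
by apply: measurable_funM => //; apply: measurableT_comp => //; exact: measurable_funM.
Qed.

(** Let [D] be the rectangle with its constraint at [e] dropped. Restricted to [D], coordinate [e]
    has law [mu D] times the exponential law, so only the one-dimensional [exponential_tilt]
    remains. *)
Lemma integral_tilt_rect (c : R) e s (B : I -> set R) : 0 < c -> uniq s -> e \in s ->
  (forall i, measurable (B i)) -> (forall i, i \notin s -> B i = setT) ->
  (\int[mu]_(f in rect B) (tilt c (coordinate e f))%:E =
   exponential_prob c (B e) * \prod_(i <- s | i != e) exponential_prob 1 (B i))%E.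
Proof.
move=> c0 us es mB sB.
pose Bx A i := if i == e then A else B i.
have mBx A i : measurable A -> measurable (Bx A i) by rewrite /Bx; case: ifP.
have sBx A i : i \notin s -> Bx A i = setT.
  by move=> is_; rewrite /Bx ifN ?sB//; apply: contraNneq is_ => ->.
have muBx A : measurable A -> mu (rect (Bx A)) =
    (exponential_prob 1 A * \prod_(i <- s | i != e) exponential_prob 1 (B i))%E.
  move=> mA; rewrite (mu_rect us (fun i => mBx A i mA) (sBx A)).
  rewrite (bigD1_seq e)//= /Bx eqxx; congr (_ * _)%E.
  by apply: eq_bigr => i /negPf ->.
pose D := rect (Bx setT).
have mD : measurable (D : set coord_space).
  by apply: (@measurable_rect s) => i; [exact: mBx|exact: sBx].
have DA A : coordinate e @^-1` A `&` D = rect (Bx A).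
  apply/seteqP; split => f /=.
    by move=> [Af Df] i; have := Df i; rewrite /Bx; case: eqP => // ->.
  move=> BAf; split; first by have := BAf e; rewrite /Bx eqxx.
  by move=> i; have := BAf i; rewrite /Bx; case: eqP.
pose p := (\prod_(i <- s | i != e) exponential_prob 1 (B i))%E.
have pE : p = mu D by rewrite muBx// exponential_probT// mul1e.
have p0 : 0 <= fine p by rewrite fine_ge0// pE.
pose nu := pushforward_measure (mrestr mu mD) (measurable_coordinate e).
have nuE A : measurable A -> nu A = mscale (NngNum p0) (exponential_law ltr01) A.
  move=> mA; rewrite /mscale/= fineK ?pE ?fin_num_measure// -pE muleC -muBx//.
  by rewrite -DA.
have mtilt A : measurable A -> measurable_fun A (fun x => (tilt c x)%:E).
  by move=> _; apply: measurable_funTS; apply/measurable_EFinP; exact: measurable_tilt.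
have tilt0 x : (0 <= (tilt c x)%:E)%E by rewrite lee_fin tilt_ge0// ltW.
transitivity (\int[nu]_(x in B e) (tilt c x)%:E)%E; last first.
  rewrite (eq_measure_integral (mscale (NngNum p0) (exponential_law ltr01))); last first.
    by move=> A mA _; exact: nuE.
  rewrite ge0_integral_mscale//; last exact: mtilt.
  by rewrite exponential_tilt// muleC/= fineK// pE fin_num_measure.
rewrite ge0_integral_pushforward//; last exact: mtilt.
have mBe : measurable (coordinate e @^-1` B e).
  by rewrite -[X in measurable X]setTI; exact: measurable_coordinate.
rewrite [LHS]integral_mkcond [RHS]integral_mkcond.
rewrite [RHS](ge0_integral_density (mu := mu) (g := \1_D))//.
- apply: eq_integral => f _.
  rewrite !patchE indicE.
  have -> : rect B = coordinate e @^-1` B e `&` D.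
    rewrite DA; congr rect; apply/funext => i; rewrite /Bx.
    by case: eqP => // ->.
  rewrite in_setI; case: (f \in D) => /=; last by rewrite mule0 andbF.
  by rewrite mule1 andbT.
- by move=> A mA; rewrite /density integral_indic// setIC.
- by move=> f; rewrite patchE; case: ifP => //= _; exact: tilt0.
- apply/(measurable_restrictT _ mBe); apply: measurable_funTS => /=.
  apply/measurable_EFinP; apply: measurableT_comp; first exact: measurable_tilt.
  exact: measurable_coordinate.
Qed.

(** The image of [mu] under the rescaling has density [tilt] at [e]; it suffices to compare the two
    measures on rectangles. *)
Lemma integral_scale_coord (c : R) e (h : coord_space -> \bar R) : 0 < c ->
  (forall f, 0 <= h f)%E -> measurable_fun setT h ->
  (\int[mu]_f h (scale_coords [:: e] c f) =
   \int[mu]_f (h f * (tilt c (coordinate e f))%:E))%E.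
Proof.
move=> c0 h0 mh.
have mg : measurable_fun setT (fun f => tilt c (coordinate e f)).
  by apply: measurableT_comp; [exact: measurable_tilt|exact: measurable_coordinate].
have g0 f : 0 <= tilt c (coordinate e f) by exact: tilt_ge0 (ltW c0).
pose nu := pushforward_measure mu (measurable_scale_coords [:: e] c).
transitivity (\int[nu]_f h f)%E.
  by rewrite ge0_integral_pushforward//; exact: measurable_scale_coords.
apply: ge0_integral_density => //.
apply: (@coord_space_measure_unique nu (density_measure mu g0 mg)).
  by rewrite (_ : nu setT = mu setT)// probability_setT ltry.
move=> _ [s [B [mB sB ->]]].
(* The list [s] may omit [e], which must be among the listed coordinates for its factor to be split
   off. *)
set s' := undup (e :: s).
have us' : uniq s' by rewrite undup_uniq.
have es' : e \in s' by rewrite mem_undup mem_head.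
have sB' i : i \notin s' -> B i = setT.
  by rewrite mem_undup inE negb_or => /andP[_ /sB].
rewrite [RHS](integral_tilt_rect c0 us' es' mB sB').
pose B' i := if i == e then (fun x => x / c) @^-1` B i else B i.
have -> : nu (rect B) = mu (rect B').
  congr (mu _); apply/seteqP; split => f /= Bf i; have := Bf i;
    by rewrite /scale_coords /B' inE; case: ifP.
rewrite (mu_rect us').
- rewrite (bigD1_seq e)//= /B' eqxx exponential_scale//.
  by congr (_ * _)%E; apply: eq_bigr => i /negPf ->.
- move=> i; rewrite /B'; case: ifP => // _; rewrite -[X in measurable X]setTI.
  exact: measurable_funM.
- by move=> i is'; rewrite /B' ifN ?sB'//; apply: contraNneq is' => ->.
Qed.

Lemma scale_coords_cons c e s f : e \notin s ->
  scale_coords (e :: s) c f = scale_coords s c (scale_coords [:: e] c f).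
Proof.
move=> es; apply/funext => i; rewrite /scale_coords !inE.
by have [->|] := eqVneq i e; rewrite ?(negPf es).
Qed.

(** One coordinate at a time: as [e] is not in [s], the factor [tilt] at [e] is unchanged by
    rescaling [s], and can be absorbed into the integrand before the induction hypothesis is
    applied. *)
Lemma integral_scale_coords (c : R) s (h : coord_space -> \bar R) : 0 < c ->
  uniq s -> (forall f, 0 <= h f)%E -> measurable_fun setT h ->
  (\int[mu]_f h (scale_coords s c f) =
   \int[mu]_f (h f * (\prod_(e <- s) tilt c (coordinate e f))%:E))%E.
Proof.
move=> c0; elim: s h => [h _ _ _|e s ih h /= /andP[es us] h0 mh].
  by apply: eq_integral => f _; rewrite big_nil mule1.
under eq_integral do rewrite scale_coords_cons//.
have mt : measurable_fun setT (fun f => (tilt c (coordinate e f))%:E).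
  apply/measurable_EFinP; apply: measurableT_comp; first exact: measurable_tilt.
  exact: measurable_coordinate.
rewrite (integral_scale_coord e c0 (h := h \o scale_coords s c)); last 2 first.
- by move=> f; exact: h0.
- by apply: measurableT_comp => //; exact: measurable_scale_coords.
pose h' f := (h f * (tilt c (coordinate e f))%:E)%E.
transitivity (\int[mu]_f h' (scale_coords s c f))%E.
  apply: eq_integral => f _; rewrite /h' /= /coordinate.
  by rewrite [scale_coords _ _ _ e]/scale_coords (negPf es).
rewrite ih//.
- by apply: eq_integral => f _; rewrite /h' big_cons EFinM -muleA.
- by move=> f; rewrite mule_ge0// lee_fin tilt_ge0// ltW.
- exact: emeasurable_funM.
Qed.

Lemma measurable_prod_tilt c s :
  measurable_fun setT (fun f => \prod_(e <- s) tilt c (coordinate e f)).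
Proof.
apply: measurable_prod => e _.
by apply: measurableT_comp; [exact: measurable_tilt|exact: measurable_coordinate].
Qed.

Lemma integral_prod_tilt (c : R) s : 0 < c -> uniq s ->
  (\int[mu]_f (\prod_(e <- s) tilt c (coordinate e f))%:E = 1)%E.
Proof.
move=> c0 us; under eq_integral do rewrite -[X in X%:E]mul1r EFinM.
rewrite -(integral_scale_coords (h := cst 1%E))//.
by rewrite integral_cst// mul1e; exact: probability_setT.
Qed.

Lemma prob_coord e A : measurable A ->
  mu (coordinate e @^-1` A) = exponential_prob 1 A.
Proof.
move=> mA; pose B i := if i == e then A else setT.
have -> : coordinate e @^-1` A = rect B.
  apply/seteqP; split => f /=; last by move/(_ e); rewrite /B eqxx.
  by move=> Af i; rewrite /B; case: eqP => [->|].
rewrite (mu_rect (s := [:: e]))//.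
- by rewrite big_seq1 /B eqxx.
- by move=> i; rewrite /B; case: ifP.
- by move=> i; rewrite inE /B => /negPf ->.
Qed.

Lemma prob_coord_lt0 e : mu [set f | coordinate e f < 0] = 0%E.
Proof.
rewrite -(exponential_prob_lt0 R) -(prob_coord e)//.
Qed.

(** Erasing the coordinates outside [D] leaves an event depending only on [D] unchanged.
    Independence can thus be proved for preimages under [restrict], where the event is an arbitrary
    measurable set and uniqueness of measures applies. *)
Let restrict (D : pred I) (f : coord_space) : coord_space :=
  fun i => if D i then f i else 0.

Let restrict_rect (D : pred I) (B : I -> set R) :
  restrict D @^-1` rect B =
  rect (fun i => if D i then B i else [set _ | B i 0]).
Proof.
by apply/seteqP; split => f /= Bf i; have := Bf i; rewrite /restrict /=; case: ifP.
Qed.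

Let measurable_restrict D : measurable_fun setT (restrict D).
Proof.
apply: measurable_to_coord_space => i; rewrite /restrict.
by case: (D i) => //; exact: measurable_coordinate.
Qed.

Let restrict_depends D A : depends_on D A -> restrict D @^-1` A = A.
Proof.
move=> DA; apply/seteqP; split => f /=; apply: DA => i Di; rewrite /restrict.
  by rewrite -[D i]/(i \in D) Di.
by rewrite -[D i]/(i \in D) Di.
Qed.

Let exponential_prob_setI (X Y : set R) : Y = set0 \/ Y = setT ->
  exponential_prob 1 (X `&` Y) =
  (exponential_prob 1 X * exponential_prob 1 Y)%E.
Proof.
move=> [] ->; last by rewrite setIT exponential_probT// mule1.
by rewrite setI0 [exponential_prob 1 set0](measure0 (exponential_law ltr01)) mule0.
Qed.

Let constant_preimage (B : set R) (x : R) :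
  [set _ : R | B x] = set0 \/ [set _ : R | B x] = setT.
Proof.
have [Bx|Bx] := pselect (B x); [right|left]; first by apply/seteqP; split.
by apply/seteqP; split.
Qed.

(** Each coordinate lies in at most one of [D] and [D']; the other rectangle then constrains it by a
    constant condition, whose set is empty or full. *)
Let restrict_independent_rect D D' A A' : [predI D & D'] =1 pred0 ->
  finite_rect A -> finite_rect A' ->
  mu (restrict D @^-1` A `&` restrict D' @^-1` A') =
  (mu (restrict D @^-1` A) * mu (restrict D' @^-1` A'))%E.
Proof.
move=> DD' [s [B [mB sB ->]]] [s' [B' [mB' sB' ->]]].
rewrite !restrict_rect rectI; pose u := undup (s ++ s').
have us : uniq u by rewrite undup_uniq.
pose C (E : pred I) (X : I -> set R) i := if E i then X i else [set _ | X i 0].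
have mC E X i : (forall i, measurable (X i)) -> measurable (C E X i).
  move=> mX; rewrite /C; case: ifP => // _.
  by have [->|->] := constant_preimage (X i) 0.
have uC E i : i \notin u -> (C E B i = setT) * (C E B' i = setT).
  rewrite mem_undup mem_cat negb_or => /andP[/sB Bi /sB' B'i].
  by rewrite /C Bi B'i; case: ifP.
rewrite -/(C D B) -/(C D' B') !(mu_rect us).
- rewrite -big_split/=; apply: eq_bigr => i _.
  have : D i && D' i = false by exact: DD'.
  rewrite /C; case: (D i) => /= [->|_].
    by apply: exponential_prob_setI; exact: constant_preimage.
  rewrite setIC muleC; apply: exponential_prob_setI; exact: constant_preimage.
- by move=> i; exact: mC.
- by move=> i iu; rewrite uC.
- by move=> i; exact: mC.
- by move=> i iu; rewrite uC.
- by move=> i; apply: measurableI; exact: mC.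
- by move=> i iu; rewrite -/(C D B i) -/(C D' B' i) !uC// setIT.
Qed.

Let measurable_restrict_preimage D A : measurable A ->
  measurable (restrict D @^-1` A).
Proof.
by move=> mA; rewrite -[X in measurable X]setTI; exact: measurable_restrict.
Qed.

(** For fixed [A'] both sides are finite measures in [A], so rectangles suffice. It is used twice,
    the second time with the roles of the two events exchanged. *)
Let restrict_independent_step D D' (A' : set coord_space) : measurable A' ->
  (forall A, finite_rect A ->
    mu (restrict D @^-1` A `&` restrict D' @^-1` A') =
    (mu (restrict D @^-1` A) * mu (restrict D' @^-1` A'))%E) ->
  forall A, measurable A ->
    mu (restrict D @^-1` A `&` restrict D' @^-1` A') =
    (mu (restrict D @^-1` A) * mu (restrict D' @^-1` A'))%E.
Proof.
move=> mA' ind A mA.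
have mrA' := measurable_restrict_preimage D' mA'.
pose p := mu (restrict D' @^-1` A').
have p0 : 0 <= fine p by apply: fine_ge0; exact: measure_ge0.
have pE : (fine p)%:E = p by rewrite fineK// fin_num_measure.
pose m1 := pushforward_measure (mrestr mu mrA') (@measurable_restrict D).
pose m2 := mscale (NngNum p0) (pushforward_measure mu (@measurable_restrict D)).
have m2E X : m2 X = (mu (restrict D @^-1` X) * p)%E.
  by rewrite /m2 /mscale/= pE muleC.
rewrite -/p -m2E; apply: (@coord_space_measure_unique m1) => //.
  rewrite -[m1 _]/(mu _); apply: le_lt_trans (ltry 1); apply: probability_le1.
  by apply: measurableI => //; exact: measurable_restrict_preimage.
by move=> X rX; rewrite -[LHS]/(mu _) ind// -m2E.
Qed.

Lemma prob_independent (D D' : pred I) (A A' : set coord_space) :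
  [predI D & D'] =1 pred0 ->
  measurable A -> measurable A' -> depends_on D A -> depends_on D' A' ->
  mu (A `&` A') = (mu A * mu A')%E.
Proof.
move=> DD' mA mA' DA D'A'.
rewrite -(restrict_depends DA) -(restrict_depends D'A').
apply: restrict_independent_step => // X rX.
have mX : measurable (X : set coord_space) by exact: sub_sigma_algebra.
rewrite setIC muleC; apply: (restrict_independent_step mX) => // Y rY.
by rewrite setIC muleC; exact: restrict_independent_rect.
Qed.

End coordinate_space.

(** * Change of rate *)

Section change_of_rate.
Variables (I : choiceType) (R : realType).
Local Notation space := (coord_space I R).
Variable mu : probability space R.
Hypothesis mu_exp : exponential_product mu.

Lemma prod_tilt_exp (theta : R) (s : seq I) (f : space) : 0 <= theta ->
  \prod_(e <- s) tilt (1 + theta) (coordinate e f) =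
  (1 + theta) ^+ size s * expR (- theta * \sum_(e <- s) coordinate e f).
Proof.
move=> theta0; elim: s => [|e s ih]; first by rewrite !big_nil mulr0 expR0 mulr1.
rewrite !big_cons ih /tilt (_ : 1 + theta - 1 = theta); last by ring.
by rewrite mulrDr expRD /= exprS; ring.
Qed.

(** A Chernoff bound, [(1 + theta)^-1] being the Laplace transform of one weight. The indicator is
    dominated by a multiple of the likelihood ratio of rate [1 + theta], whose mean is 1. *)
Lemma prob_sum_le (theta y : R) (s : seq I) : 0 <= theta -> uniq s ->
  (mu [set f : space | (\sum_(e <- s) coordinate e f <= y)%R]
   <= (expR (theta * y) * (1 + theta) ^- size s)%:E)%E.
Proof.
move=> theta0 us; set A := [set f | _].
have c0 : 0 < 1 + theta by rewrite ltr_pwDl.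
have mA : measurable (A : set space).
  have mS : measurable_fun setT (fun f : space => \sum_(e <- s) coordinate e f).
    by apply: measurable_sum => e; exact: measurable_coordinate.
  rewrite (_ : A = (fun f : space => \sum_(e <- s) coordinate e f) @^-1` `]-oo, y]);
    last first.
    by apply/seteqP; split => f /=; rewrite in_itv.
  by rewrite -[X in measurable X]setTI; exact: mS.
have mW := measurable_prod_tilt (1 + theta) s.
set k := expR (theta * y) * (1 + theta) ^- size s.
have k0 : 0 <= k by rewrite mulr_ge0 ?expR_ge0// invr_ge0 exprn_ge0// ltW.
rewrite -[X in mu X]setIT -integral_indic//.
apply: (@le_trans _ _ (\int[mu]_f
    (k%:E * (\prod_(e <- s) tilt (1 + theta) (coordinate e f))%:E))%E).
  apply: ge0_le_integral => //.
  - exact/measurable_EFinP.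
  - by apply: emeasurable_funM => //; exact/measurable_EFinP.
  move=> f _; rewrite -EFinM lee_fin prod_tilt_exp// /k.
  rewrite mulrA divfK; last by rewrite expf_neq0// gt_eqF.
  rewrite -expRD mulNr -mulrBr indicE.
  case: (boolP (f \in A)) => [/set_mem Af|_]; last exact: expR_ge0.
  by rewrite -[1]expR0 ler_expR mulr_ge0// subr_ge0.
rewrite ge0_integralZl//; last 2 first.
- exact/measurable_EFinP.
- by move=> f _; rewrite lee_fin prodr_ge0// => e _; rewrite tilt_ge0// ltW.
by rewrite integral_prod_tilt// mule1.
Qed.

(** The [N]-th power of [exp (- eps x)] is [exp (- N eps x)], the tilt of rate [1 + N eps] up to
    normalization. Since that tilt has mean 1, the prefactor is exactly the [N]-th moment. *)
Lemma tilt_prod_expn (eps : R) N (s : seq I) (f : space) : 0 <= eps ->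
  (\prod_(e <- s) tilt (1 + eps) (coordinate e f)) ^+ N =
  ((1 + eps) ^+ N / (1 + N%:R * eps)) ^+ size s *
  \prod_(e <- s) tilt (1 + N%:R * eps) (coordinate e f).
Proof.
move=> eps0; have N0 : 0 <= N%:R * eps by rewrite mulr_ge0.
rewrite !prod_tilt_exp// mulrA -exprMn divfK; last by rewrite gt_eqF// ltr_pwDl.
by rewrite exprMn -expRM_natl exprAC; congr (_ * expR _); ring.
Qed.

(** Above the level [lam], the factor [(W / lam) ^ N] is at least 1. *)
Lemma le_markov_power (lam W : R) N : 0 < lam -> 0 <= W ->
  W <= lam + lam ^- N * W ^+ N.+1.
Proof.
move=> lam0 W0; have [Wlam|lamW] := leP W lam.
  by rewrite (le_trans Wlam)// lerDl mulr_ge0 ?invr_ge0 ?exprn_ge0// ltW.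
rewrite -[leLHS]add0r lerD//; first exact: ltW.
rewrite exprS mulrCA ler_peMr//.
by rewrite -exprVn -exprMn exprn_ege1// mulrC ler_pdivlMr// mul1r ltW.
Qed.

(* Raising the rates on [s] to [1 + eps] has likelihood ratio the product of the
   tilts; [lam] truncates it, the excess being controlled by its [N.+1]-st
   moment. *)
Lemma prob_scale_le (eps lam : R) N (s : seq I) (A : set space) :
  0 <= eps -> 0 < lam -> uniq s -> measurable A ->
  (mu (scale_coords s (1 + eps) @^-1` A) <=
   lam%:E * mu A +
   (lam ^- N * ((1 + eps) ^+ N.+1 / (1 + N.+1%:R * eps)) ^+ size s)%:E)%E.
Proof.
move=> eps0 lam0 us mA.
have c0 : 0 < 1 + eps by rewrite ltr_pwDl.
have cN0 : 0 < 1 + N.+1%:R * eps by rewrite ltr_pwDl// mulr_ge0.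
have mW c : measurable_fun setT
    (fun f : space => (\prod_(e <- s) tilt c (coordinate e f))%:E).
  by apply/measurable_EFinP; exact: measurable_prod_tilt.
set k := lam ^- N * _.
have k0 : 0 <= k.
  rewrite mulr_ge0 ?invr_ge0 ?exprn_ge0 ?(ltW lam0)//.
  by rewrite divr_ge0 ?exprn_ge0// ltW.
have m1A : measurable_fun setT (fun f : space => (\1_A f : R)%:E).
  exact/measurable_EFinP.
have W0 c (f : space) : 0 < c -> 0 <= \prod_(e <- s) tilt c (coordinate e f).
  by move=> ?; rewrite prodr_ge0// => e _; rewrite tilt_ge0// ltW.
have -> : mu (scale_coords s (1 + eps) @^-1` A) =
    (\int[mu]_f (\1_A (scale_coords s (1 + eps) f))%:E)%E.
  rewrite -[X in mu X]setIT -integral_indic//.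
  by rewrite -[X in measurable X]setTI; exact: measurable_scale_coords.
rewrite (integral_scale_coords mu_exp (h := fun f => (\1_A f)%:E))//.
apply: (@le_trans _ _ (\int[mu]_f (lam%:E * (\1_A f)%:E +
    k%:E * (\prod_(e <- s) tilt (1 + N.+1%:R * eps) (coordinate e f))%:E))%E).
  apply: ge0_le_integral => //.
  - by move=> f _; rewrite mule_ge0// lee_fin ?W0.
  - exact: emeasurable_funM.
  - apply: emeasurable_funD; exact: emeasurable_funM.
  move=> f _; rewrite -!EFinM -EFinD lee_fin -mulrA -tilt_prod_expn//.
  rewrite indicE; case: (f \in A); rewrite ?mul1r ?mulr1 ?mul0r ?mulr0 ?add0r.
    by apply: le_markov_power => //; exact: W0.
  by rewrite mulr_ge0 ?invr_ge0 ?exprn_ge0 ?W0// ltW.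
rewrite ge0_integralD//; last 4 first.
- by move=> f _; rewrite mule_ge0// lee_fin ltW.
- exact: emeasurable_funM.
- by move=> f _; rewrite mule_ge0// lee_fin W0.
- exact: emeasurable_funM.
rewrite !ge0_integralZl//; last 2 first.
- by move=> f _; rewrite lee_fin W0.
- by rewrite lee_fin ltW.
by rewrite integral_indic// setIT (integral_prod_tilt mu_exp)// mule1.
Qed.

End change_of_rate.

(** * Lattice paths and cylinders *)

Section lattice_paths.

(** A code determines its unordered pair of endpoints; locating one endpoint is enough to contradict
    the absence of a vertex from the rest of a path. *)
Lemma edge_of_inj (u v u' v' : vertex) : Defs.adjacent u v -> Defs.adjacent u' v' ->
  edge_of u v = edge_of u' v' -> u = u' \/ u = v'.
Proof.
case: u v u' v' => [a b] [c e] [a' b'] [c' e'].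
rewrite /Defs.adjacent /edge_of /= => ad ad' [h1 h2 h3].
have [[-> ->]|[-> ->]] : (a = a' /\ b = b') \/ (a = c' /\ b = e') by lia.
  by left.
by right.
Qed.

Lemma path_adjacent_le (x : vertex) s : path Defs.adjacent x s ->
  (last x s).1 <= x.1 + (size s)%:Z.
Proof.
elim: s x => [x _|y s ih x /= /andP[xy /ih]]; first by rewrite addr0.
by move: xy; rewrite /Defs.adjacent; lia.
Qed.

Lemma uniq_pairmap_edge_of (x : vertex) s : path Defs.adjacent x s ->
  uniq (x :: s) -> uniq (pairmap edge_of x s).
Proof.
elim: s x => [//|y s ih] x /= /andP[xy ps] /and3P[xs ys us].
rewrite ih ?andbT/= ?ys//.
suff H z t : path Defs.adjacent z t -> x \notin z :: t ->
    edge_of x y \notin pairmap edge_of z t by exact: H.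
elim: t z => [//|v t iht] z /= /andP[zv pt] xzt.
rewrite inE negb_or iht ?andbT//; last by move: xzt; rewrite !inE !negb_or => /andP[].
apply/eqP => /(edge_of_inj xy zv)[xz|xv]; move: xzt.
  by rewrite inE xz eqxx.
by rewrite !inE xv eqxx orbT.
Qed.

Definition neighbours (x : vertex) : seq vertex :=
  [:: (x.1 + 1, x.2); (x.1 - 1, x.2); (x.1, x.2 + 1); (x.1, x.2 - 1)].

Lemma mem_neighbours x y : Defs.adjacent x y -> y \in neighbours x.
Proof.
case: x y => [a b] [c e]; rewrite /Defs.adjacent /neighbours !inE !xpair_eqE /=; lia.
Qed.

(** All nearest-neighbour walks, self-avoiding or not: the crude count [4 ^ n] is enough for the
    Peierls bound. *)
Fixpoint walks (n : nat) (x : vertex) : seq (seq vertex) :=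
  if n is n'.+1 then [seq y :: s | y <- neighbours x, s <- walks n' y]
  else [:: [::]].

Lemma walksS n x :
  walks n.+1 x = [seq y :: s | y <- neighbours x, s <- walks n y].
Proof. by []. Qed.

Lemma size_walks n x : size (walks n x) = (4 ^ n)%N.
Proof.
elim: n x => [//|n ih] x; rewrite size_allpairs_dep /=.
by rewrite !ih expnS; lia.
Qed.

Lemma mem_walks x s : path Defs.adjacent x s -> s \in walks (size s) x.
Proof.
elim: s x => [//|y s ih] x.
rewrite [path _ _ _]/= [size _]/= walksS => /andP[/mem_neighbours xy /ih ys].
by apply/allpairsPdep; exists y, s.
Qed.

(** Writing the set of used edges into the step relation makes loop removal by [shortenP] keep track
    of them: the shortened path uses only edges of the original one. *)
Lemma path_path_edges x s : path Defs.adjacent x s ->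
  path [rel u v | Defs.adjacent u v && (edge_of u v \in pairmap edge_of x s)] x s.
Proof.
suff H z t : {subset pairmap edge_of z t <= pairmap edge_of x s} ->
    path Defs.adjacent z t ->
    path [rel u v | Defs.adjacent u v && (edge_of u v \in pairmap edge_of x s)] z t.
  by apply: H.
elim: t z => [//|v t ih] z /= sub /andP[-> pt].
rewrite sub ?mem_head//= ih// => e et; apply: sub.
by rewrite inE et orbT.
Qed.

Lemma path_subset_edges (x : vertex) s (E : seq edge) :
  path [rel u v | Defs.adjacent u v && (edge_of u v \in E)] x s ->
  path Defs.adjacent x s /\ {subset pairmap edge_of x s <= E}.
Proof.
elim: s x => [//|y s ih] x /= /andP[/andP[-> xy] /ih[-> sub]].
by split => // e; rewrite inE => /predU1P[->|/sub].
Qed.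

(** Remove loops, then keep the first [n] steps, which exist because each step changes the first
    coordinate by at most 1. The piece need not reach the right side; what matters is that it has
    exactly [n] distinct edges. *)
Lemma crossing_self_avoiding n K j x s : crossing n K j x s ->
  exists s', [/\ s' \in walks n x, uniq (pairmap edge_of x s') &
                 {subset pairmap edge_of x s' <= path_edges x s}].
Proof.
move=> /and4P[ps _ /eqP x0 /eqP xn].
have := path_path_edges ps; set e := (X in path X) => pe.
have : (last x s).1 = n%:Z by [].
case/shortenP: pe => p' pe' up' _ lastp'.
have [pp' _] := path_subset_edges pe'.
have np' : (n <= size p')%N.
  by have := path_adjacent_le pp'; rewrite lastp' x0 add0r lez_nat.
have pet : path e x (take n p') by exact: take_path.
have [pt sub] := path_subset_edges pet.
have st : size (take n p') = n by rewrite size_takel.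
exists (take n p'); split.
- by rewrite -{2}st; exact: mem_walks.
- apply: uniq_pairmap_edge_of => //.
  by have := take_uniq n.+1 up'.
- by move=> z /sub; rewrite mem_undup.
Qed.

End lattice_paths.

Section cylinders.
Variables (n : nat) (K : nat -> nat).

Definition strip_bottom (j : nat) : nat := (\sum_(1 <= i < j) K i)%N.

Lemma strip_bottomS j : (0 < j)%N -> strip_bottom j.+1 = (strip_bottom j + K j)%N.
Proof. by move=> j0; rewrite /strip_bottom big_nat_recr. Qed.

(** Edges are sorted by their base vertex, so those leaving the cylinder upwards or to the right are
    included. This keeps different strips disjoint and the count exact. *)
Definition strip (j : nat) : seq edge :=
  [seq (v, b) | v <- [seq (Posz a, Posz c) | a <- iota 0 n.+1,
                                           c <- iota (strip_bottom j) (K j)],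
                b <- [:: true; false]].

Lemma uniq_strip j : uniq (strip j).
Proof.
apply: allpairs_uniq => //; last by move=> [? ?] [? ?] _ _ [-> ->].
apply: allpairs_uniq; rewrite ?iota_uniq//.
by move=> [? ?] [? ?] _ _ [-> ->].
Qed.

Lemma size_strip j : size (strip j) = (2 * n.+1 * K j)%N.
Proof. by rewrite !size_allpairs !size_iota /=; lia. Qed.

Lemma mem_strip j (e : edge) : (0 < j)%N ->
  (e \in strip j) = in_cylinder n K j e.1.
Proof.
move=> j0; rewrite /in_cylinder -/(strip_bottom j) -/(strip_bottom j.+1).
rewrite strip_bottomS//; apply/idP/idP => [|h].
  move=> /allpairsP[p [/allpairsP[q [+ + ->]] _ ->]].
  by rewrite !mem_iota /=; lia.
case: e h => [[[a|a] [c|c]] b] /= h; try by lia.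
apply/allpairsP; exists ((Posz a, Posz c), b); split => //; last by case: b.
by apply/allpairsP; exists (a, c); split => //; rewrite mem_iota /=; lia.
Qed.

Lemma in_cylinder_edge_of j (x y : vertex) : in_cylinder n K j x ->
  in_cylinder n K j y -> in_cylinder n K j (edge_of x y).1.
Proof. by case: x y => [a b] [c e]; rewrite /in_cylinder /=; lia. Qed.

Lemma path_edges_strip j x s e : all (in_cylinder n K j) (x :: s) ->
  e \in path_edges x s -> in_cylinder n K j e.1.
Proof.
rewrite mem_undup; elim: s x => [//|y s ih] x /= /and3P[cx cy cs].
rewrite inE => /orP[/eqP ->|]; first exact: in_cylinder_edge_of.
by apply: ih; rewrite /= cy.
Qed.

(** The horizontal segment along the bottom. Without a crossing, the infimum defining the passage
    time would be the default value 0. *)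
Lemma crossing_exists j : (0 < j)%N -> (0 < K j)%N ->
  exists x s, crossing n K j x s.
Proof.
move=> j0 Kj; pose v k : vertex := (Posz k, Posz (strip_bottom j)).
exists (v 0%N), [seq v k | k <- iota 1 n]; rewrite /crossing.
have cv k : (k <= n)%N -> in_cylinder n K j (v k).
  move=> kn; rewrite /in_cylinder -/(strip_bottom j) -/(strip_bottom j.+1).
  by rewrite strip_bottomS//= ; lia.
apply/and4P; split => //=.
- have : forall m k, path Defs.adjacent (v k) [seq v i | i <- iota k.+1 m]; last exact.
  elim=> [//|m ih] k /=; rewrite ih andbT /Defs.adjacent /=; lia.
- rewrite cv//=; apply/allP => _ /mapP[k + ->]; rewrite mem_iota => kn.
  by apply: cv; lia.
- rewrite last_map; suff H m k : last k (iota k.+1 m) = (k + m)%N by rewrite H.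
  by elim: m k => [k|m ih k] /=; rewrite ?addn0// ih addSnnS.
Qed.

End cylinders.

(** * Passage times *)

Section min_upto_theory.
Variables (R : realType) (r : nat) (F : nat -> R).
Hypothesis r0 : (0 < r)%N.

Lemma min_upto_le j : (1 <= j <= r)%N -> min_upto r F <= F j.
Proof. by move=> jr; apply: ge_bigmin_seq => //; rewrite mem_index_iota ltnS. Qed.

Lemma min_upto_attained : exists2 j, (1 <= j <= r)%N & min_upto r F = F j.
Proof.
suff H (s : seq nat) : {subset s <= [pred j | (1 <= j <= r)%N]} ->
    exists2 j, (1 <= j <= r)%N & \big[Num.min/F 1%N]_(i <- s) F i = F j.
  by apply: H => j; rewrite mem_index_iota ltnS.
elim: s => [_|i s ih sub]; first by exists 1%N; rewrite ?big_nil.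
have [j js jE] : exists2 j, (1 <= j <= r)%N &
    \big[Num.min/F 1%N]_(i <- s) F i = F j.
  by apply: ih => j js; apply: sub; rewrite inE js orbT.
rewrite big_cons jE; case: leP => _; last by exists j.
by exists i => //; apply: (sub i); rewrite mem_head.
Qed.

Lemma lt_min_upto y :
  (y < min_upto r F) <-> (forall j, (1 <= j <= r)%N -> y < F j).
Proof.
split => [yF j jr|yF]; first exact: lt_le_trans (min_upto_le jr).
by have [j jr ->] := min_upto_attained; exact: yF.
Qed.

End min_upto_theory.

(** No condition on [A] is required: if it has no infimum, neither has its multiple, and both sides
    are the default value 0. *)
Lemma infZ (R : realType) (k : R) (A : set R) : 0 < k ->
  inf [set k * x | x in A] = k * inf A.
Proof.
move=> k0; have k'0 : 0 < k^-1 by rewrite invr_gt0.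
have [Ainf|Ainf] := pselect (has_inf A); last first.
  rewrite (inf_out Ainf) mulr0 inf_out// => -[[_ [x Ax _]] [m mA]]; apply: Ainf.
  split; first by exists x.
  exists (k^-1 * m) => y Ay; rewrite ler_pdivrMl//.
  by apply: mA; exists y.
have [A0 Al] := Ainf.
apply/eqP; rewrite eq_le; apply/andP; split.
  rewrite -ler_pdivrMl//; apply: lb_le_inf => // x Ax.
  rewrite ler_pdivrMl//; apply: ge_inf; last by exists x.
  by exists (k * inf A) => _ [y Ay <-]; rewrite ler_pM2l//; exact: ge_inf.
apply: lb_le_inf => [|_ [y Ay <-]]; first by case: A0 => x Ax; exists (k * x), x.
by rewrite ler_pM2l//; exact: ge_inf.
Qed.

Lemma measure_bigsetU_le d (T : measurableType d) (R : realType)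
    (mu : {measure set T -> \bar R}) (X : Type) (l : seq X) (F : X -> set T) :
  (forall x, measurable (F x)) ->
  (mu (\big[setU/set0]_(x <- l) F x) <= \sum_(x <- l) mu (F x))%E.
Proof.
move=> mF; elim: l => [|x l ih]; first by rewrite !big_nil measure0.
rewrite !big_cons (le_trans (measureU2 _ _ _))//; last exact: leeD2l.
exact: bigsetU_measurable.
Qed.

Section passage_times.
Variable R : realType.
Local Notation space := (coord_space edge R).
Variable mu : probability space R.
Hypothesis mu_exp : exponential_product mu.

Definition weight (e : edge) : {RV mu >-> R} := coordinate e.

Variables (n : nat) (K : nat -> nat).
Local Notation cyl := (cylinder_time weight n K).

(** [g] is free outside the cylinder. Thus [c = 1] expresses locality, and [c = 1 + eps] the effect
    of rescaling a single strip. *)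
Lemma cylinder_time_scale (c : R) j (f g : space) : 0 < c ->
  (forall e, in_cylinder n K j e.1 -> g e = f e / c) ->
  cyl j g = cyl j f / c.
Proof.
move=> c0 fg; rewrite [RHS]mulrC -infZ ?invr_gt0// /cylinder_time; congr inf.
have E p : crossing n K j p.1 p.2 -> passage_time weight p.1 p.2 g =
    c^-1 * passage_time weight p.1 p.2 f.
  move=> /and4P[_ pc _ _]; rewrite /passage_time big_distrr/= big_seq_cond.
  rewrite [RHS]big_seq_cond; apply: eq_bigr => e; rewrite andbT => ep.
  by rewrite mulrC /= /coordinate fg//; exact: path_edges_strip ep.
apply/seteqP; split => [_ [p pc <-]|_ [_ [p pc <-] <-]].
  by exists (passage_time weight p.1 p.2 f); [exists p|rewrite E].
by exists p => //; rewrite E.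
Qed.

Lemma cylinder_time_eq j (f g : space) :
  (forall e, in_cylinder n K j e.1 -> g e = f e) -> cyl j g = cyl j f.
Proof.
by move=> fg; rewrite (@cylinder_time_scale 1 j f g) ?divr1// => e /fg ->; rewrite divr1.
Qed.

Lemma measurable_cylinder_time_lt j y :
  measurable [set f : space | y < cyl j f].
Proof.
rewrite (_ : [set _ | _] = cyl j @^-1` `]y, +oo[).
  by rewrite -[X in measurable X]setTI; exact: measurable_cylinder_time.
by apply/seteqP; split => f /=; rewrite in_itv/= andbT.
Qed.

Lemma measurable_cylinder_time_le j y :
  measurable [set f : space | cyl j f <= y].
Proof.
rewrite (_ : [set _ | _] = cyl j @^-1` `]-oo, y]).
  by rewrite -[X in measurable X]setTI; exact: measurable_cylinder_time.
by apply/seteqP; split => f /=; rewrite in_itv.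
Qed.

(* [63] is chosen so that the [4 ^ n] walks from each of the [n] starting points
   are beaten by the Chernoff bound [(e / 64) ^ n] for a single walk. *)
Lemma prob_min_cylinder_time_lt r : (0 < n)%N -> (0 < r)%N ->
  (forall j, (1 <= j <= r)%N -> (0 < K j)%N) -> strip_bottom K r.+1 = n ->
  (mu [set f : space | (min_cylinder_time weight n r K f < n%:R / 63)%R]
   <= (1 / 4)%:E)%E.
Proof.
move=> n0 r0 K0 Kn; set y : R := n%:R / 63.
pose start : seq vertex := [seq (Posz 0, Posz i) | i <- iota 0 n].
pose L := [seq pairmap edge_of x s | x <- start, s <- walks n x].
pose L' := [seq l <- L | uniq l & size l == n].
(* Negative weights form a null event, to be removed because the comparison of a crossing with its
   [n]-step piece drops edges and needs their weights nonnegative. *)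
pose M := flatten [seq strip n K j | j <- iota 1 r].
pose neg e : set space := [set f | coordinate e f < 0].
pose low l : set space := [set f | \sum_(e <- l) coordinate e f <= y].
have mneg e : measurable (neg e).
  rewrite (_ : neg e = coordinate e @^-1` `]-oo, 0[).
    by rewrite -[X in measurable X]setTI; exact: measurable_coordinate.
  by apply/seteqP; split => f /=; rewrite in_itv.
have mlow l : measurable (low l).
  have mS : measurable_fun setT (fun f : space => \sum_(e <- l) coordinate e f).
    by apply: measurable_sum => e; exact: measurable_coordinate.
  rewrite (_ : low l = (fun f : space => \sum_(e <- l) coordinate e f) @^-1` `]-oo, y]).
    by rewrite -[X in measurable X]setTI; exact: mS.
  by apply/seteqP; split => f /=; rewrite in_itv.
have sub : [set f : space | (min_cylinder_time weight n r K f < y)%R] `<=`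
    \big[setU/set0]_(e <- M) neg e `|` \big[setU/set0]_(l <- L') low l.
  move=> f /=; rewrite /min_cylinder_time.
  have [j jr ->] := min_upto_attained (fun j => cyl j f) r0 => cjy.
  rewrite -!bigcup_seq; apply: contrapT => /not_orP[nneg nlow].
  have f0 e : in_cylinder n K j e.1 -> 0 <= f e.
    move=> ej; rewrite leNgt; apply/negP => fe0; apply: nneg; exists e => //=.
    apply/flattenP; exists (strip n K j); last by rewrite mem_strip//; case/andP: jr.
    by apply/mapP; exists j => //; rewrite mem_iota; lia.
  have [x0 [s0 cross0]] : exists x s, crossing n K j x s.
    by apply: crossing_exists; [case/andP: jr|exact: K0].
  have /inf_lt[|_ [[x s] /= xs <-] xsy] := cjy.
    by exists (passage_time weight x0 s0 f), (x0, s0).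
  have [s' [s'n us' sub]] := crossing_self_avoiding xs.
  apply: nlow; exists (pairmap edge_of x s') => /=.
    rewrite mem_filter us' size_pairmap/=.
    have -> : size s' = n.
      suff H m z t : t \in walks m z -> size t = m by exact: H s'n.
      elim: m z t => [|m ih] z t; first by rewrite inE => /eqP ->.
      by rewrite walksS => /allpairsPdep[v [u [_ /ih <- ->]]].
    rewrite eqxx/=; apply/allpairsPdep; exists x, s'; split => //.
    case/and4P: (xs) => _ /= /andP[+ _] /eqP + _.
    rewrite /in_cylinder -/(strip_bottom K j) -/(strip_bottom K j.+1).
    have : (strip_bottom K j.+1 <= strip_bottom K r.+1)%N.
      rewrite /strip_bottom [leqRHS](@big_cat_nat _ _ _ j.+1)//=; last by case/andP: jr.
      exact: leq_addr.
    rewrite Kn; case: x {xs xsy sub us' s'n} => [a [b|b]] /= bn h a0; last by lia.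
    by rewrite a0; apply/mapP; exists b => //; rewrite mem_iota; lia.
  rewrite /low /=; apply: le_trans (ltW xsy).
  rewrite /passage_time [leRHS](bigID (mem (pairmap edge_of x s')))/=.
  rewrite -[leLHS]addr0 lerD//; last first.
    rewrite big_seq_cond sumr_ge0// => e /andP[ep _]; apply: f0.
    by apply: path_edges_strip ep; case/and4P: xs.
  rewrite -[leRHS]big_filter [leRHS](perm_big (pairmap edge_of x s'))//.
  apply: uniq_perm => //; first by rewrite filter_uniq// undup_uniq.
  move=> e; rewrite mem_filter; case: (boolP (e \in pairmap _ _ _)) => //= es.
  by rewrite sub.
have mM : measurable (\big[setU/set0]_(e <- M) neg e) by exact: bigsetU_measurable.
have mL : measurable (\big[setU/set0]_(l <- L') low l) by exact: bigsetU_measurable.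
have mA : measurable [set f : space | (min_cylinder_time weight n r K f < y)%R].
  rewrite (_ : [set _ | _] = min_cylinder_time weight n r K @^-1` `]-oo, y[).
    by rewrite -[X in measurable X]setTI; exact: measurable_min_cylinder_time.
  by apply/seteqP; split => f /=; rewrite in_itv.
apply: (@le_trans _ _ (mu (\big[setU/set0]_(e <- M) neg e `|`
                           \big[setU/set0]_(l <- L') low l))).
  by apply: le_measure; rewrite ?inE//; exact: measurableU.
apply: le_trans (measureU2 _ _ _) _ => //.
have M0 : (mu (\big[setU/set0]_(e <- M) neg e) <= 0)%E.
  apply: le_trans (measure_bigsetU_le mu M mneg) _.
  by rewrite big1// => e _; exact: prob_coord_lt0.
apply: le_trans (leeD M0 (measure_bigsetU_le mu L' mlow)) _; rewrite add0e.
have sL : (size L <= n * 4 ^ n)%N.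
  rewrite size_allpairs_dep /start.
  rewrite (eq_map (g := fun=> (4 ^ n)%N)); last by move=> x; exact: size_walks.
  rewrite sumnE big_map big_const_seq count_predT iter_addn_0 size_map.
  by rewrite size_iota mulnC.
pose q : R := expR 1 ^+ n * 64 ^- n.
have lowq l : l \in L' -> (mu (low l) <= q%:E)%E.
  rewrite mem_filter => /andP[/andP[ul /eqP sl] _].
  apply: le_trans (prob_sum_le mu_exp (theta := 63) y _ ul) _ => //.
  rewrite lee_fin sl /q -expRM_natl /y mulr1 mulrCA divff// mulr1.
  by have -> : 1 + 63 = 64 :> R by ring.
apply: (@le_trans _ _ (\sum_(l <- L') q%:E)%E).
  by rewrite !big_seq; apply: lee_sum => l; exact: lowq.
rewrite sumEFin lee_fin big_const_seq iter_addr_0 count_predT.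
have q0 : 0 <= q by rewrite mulr_ge0 ?exprn_ge0 ?expR_ge0// invr_ge0 exprn_ge0.
(* This crude bound suffices: [4 e / 64 <= 1 / 4], so the union over walks costs at most
   [n 4 ^ (- n) <= 1 / 4]. *)
have e4 : expR 1 <= 4 :> R.
  have h : expR (1 / 2) <= 2 :> R.
    rewrite -[leLHS]invrK -expRN -[leRHS]invrK lef_pV2 ?posrE ?expR_gt0 ?invr_gt0//.
    by apply: le_trans (expR_ge1Dx _); lra.
  rewrite [X in expR X](_ : 1 = 1 / 2 + 1 / 2); last by lra.
  by rewrite expRD; have := expR_ge0 (1 / 2 : R); nra.
apply: (@le_trans _ _ (q *+ (n * 4 ^ n))).
  rewrite -[leLHS]mulr_natr -[leRHS]mulr_natr ler_wpM2l// ler_nat.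
  by rewrite (leq_trans _ sL)// size_filter count_size.
have qle : q * (4 ^ n)%:R <= (4^-1) ^+ n.
  rewrite /q -exprVn -exprMn natrX -exprMn.
  rewrite lerXn2r ?nnegrE ?mulr_ge0 ?expR_ge0 ?invr_ge0//; lra.
rewrite -[leLHS]mulr_natr natrM mulrCA.
apply: le_trans (ler_wpM2l _ qle) _ => //.
suff H m : m.+1%:R * (4^-1) ^+ m.+1 <= 1 / 4 :> R by rewrite -(prednK n0).
elim: m => [|m ih]; first by rewrite expr1; lra.
apply: le_trans ih; rewrite exprS mulrCA mulrA ler_wpM2r ?exprn_ge0 ?invr_ge0//.
by rewrite ler_pdivrMl// -[m.+2%:R]natr1 -[m.+1%:R]natr1; have := ler0n R m; lra.
Qed.

End passage_times.

(** * Fluctuations of the minimum *)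

Section likelihood_ratio_bound.
Variable R : realType.

(** From [exp (u ^ 2 - u) >= 1 - u + u ^ 2] and [(1 + u) (1 - u + u ^ 2) = 1 + u ^ 3 >= 1]. *)
Lemma expR_le_add1 (u : R) : 0 <= u -> expR (u - u ^+ 2) <= 1 + u.
Proof.
move=> u0; have h := expR_ge1Dx (u ^+ 2 - u).
have e0 := expR_gt0 (u ^+ 2 - u).
rewrite -[u - _]opprB expRN -[_^-1]mul1r ler_pdivrMr//.
by apply: (@le_trans _ _ ((1 + u) * (1 + (u ^+ 2 - u)))); nra.
Qed.

(** With [u = N.+1 eps], the numerator is at most [exp u] and the denominator at least
    [exp (u - u ^ 2)]: first-order terms cancel, leaving [exp (u ^ 2)] per edge. *)
Lemma likelihood_moment_le (eps b : R) (N m : nat) : 0 <= eps ->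
  m%:R * (N.+1%:R * eps) ^+ 2 <= b ->
  ((1 + eps) ^+ N.+1 / (1 + N.+1%:R * eps)) ^+ m <= expR b.
Proof.
move=> eps0 mb; set u := N.+1%:R * eps.
have u0 : 0 <= u by rewrite mulr_ge0.
have c0 : 0 < 1 + u by rewrite ltr_pwDl.
apply: (@le_trans _ _ (expR (m%:R * u ^+ 2))); last by rewrite ler_expR.
rewrite expRM_natl; apply: lerXn2r; rewrite ?nnegrE ?expR_ge0//.
  by rewrite divr_ge0 ?exprn_ge0 ?addr_ge0.
rewrite ler_pdivrMr//; apply: (@le_trans _ _ (expR u)).
  rewrite /u expRM_natl; apply: lerXn2r; rewrite ?nnegrE ?expR_ge0 ?addr_ge0//.
  exact: expR_ge1Dx.
rewrite -[u in leLHS](subrK (u ^+ 2)) addrC expRD ler_wpM2l ?expR_ge0//.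
exact: expR_le_add1.
Qed.

(** In the exponent 17, 16 pays for the moment bound [exp (16 N)] and 1 for [r <= exp N]; the factor
    8 pays for the 8 in the target [1 / (8 r)]. *)
Definition truncation : R := 8 * expR 17.

Lemma truncation_gt0 : 0 < truncation.
Proof. by rewrite mulr_gt0 ?expR_gt0. Qed.

Lemma truncation_le (eps : R) (n k r : nat) : (0 < n)%N -> (0 < r)%N ->
  0 <= eps -> eps ^+ 2 * (n%:R * k%:R * (1 + ln r%:R)) <= 1 ->
  exists N, truncation ^- N *
    ((1 + eps) ^+ N.+1 / (1 + N.+1%:R * eps)) ^+ (2 * n.+1 * k) <=
    (8 * r%:R)^-1.
Proof.
move=> n0 r0 eps0 h.
have lr0 : 0 <= ln (r%:R : R) by rewrite ln_ge0// ler1n.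
(* This choice gives both [r <= exp N] and [1 <= N <= 1 + ln r]. *)
pose N := (Num.truncn (ln (r%:R : R))).+1.
have /andP[Nl Nu] : ((N.-1)%:R <= ln (r%:R : R)) && (ln (r%:R : R) < N%:R).
  by apply: truncn_itv.
have N1E : (N.-1)%:R = N%:R - 1 :> R by rewrite -[N in RHS]prednK// -natr1 addrK.
have N1 : 1 <= N%:R :> R by rewrite ler1n.
have rN : r%:R <= expR N%:R :> R.
  by rewrite -[leLHS]lnK ?posrE ?ltr0n// ler_expR ltW.
exists N.
(* The 16 comes from [2 (n + 1) <= 4 n] and [(N + 1) ^ 2 <= 4 N ^ 2]; one factor [N] is then
   absorbed by the hypothesis on [eps]. *)
have ek : (2 * n.+1 * k)%:R * (N.+1%:R * eps) ^+ 2 <= 16 * N%:R.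
  have x0 : 0 <= eps ^+ 2 * (n%:R * k%:R).
    by rewrite mulr_ge0 ?sqr_ge0// mulr_ge0.
  have x1 : eps ^+ 2 * (n%:R * k%:R) * N%:R <= 1.
    apply: le_trans h; rewrite [leRHS]mulrA ler_wpM2l//; lra.
  apply: (@le_trans _ _ ((4 * (n%:R * k%:R)) * ((2 * N%:R) ^+ 2 * eps ^+ 2))).
    rewrite exprMn; apply: ler_pM => //.
    - by rewrite mulr_ge0 ?sqr_ge0.
    - rewrite -!natrM ler_nat; nia.
    - rewrite ler_wpM2r ?sqr_ge0// lerXn2r ?nnegrE ?mulr_ge0//.
      by rewrite -natr1; lra.
  have -> : 4 * (n%:R * k%:R) * ((2 * N%:R) ^+ 2 * eps ^+ 2) =
    16 * N%:R * (eps ^+ 2 * (n%:R * k%:R) * N%:R) :> R by ring.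
  by rewrite ler_piMr// mulr_ge0.
have W := likelihood_moment_le eps0 ek.
have L : 8 * r%:R * expR (16 * N%:R) <= truncation ^+ N.
  rewrite /truncation exprMn -expRM_natr.
  rewrite (_ : 17 * N%:R = N%:R + 16 * N%:R :> R); last by ring.
  rewrite expRD mulrA ler_wpM2r ?expR_ge0//; apply: ler_pM => //.
  by rewrite /N exprS ler_peMr// exprn_ege1// ler1n.
have t0 : 0 < truncation ^+ N by rewrite exprn_gt0// truncation_gt0.
have r8 : 0 < 8 * r%:R :> R by rewrite mulr_gt0// ltr0n.
apply: (le_trans (ler_wpM2l _ W)); first by rewrite invr_ge0 ltW.
by rewrite ler_pdivrMl// ler_pdivlMr// [leLHS]mulrC.
Qed.

End likelihood_ratio_bound.

Section fluctuations.
Variable R : realType.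
Local Notation space := (coord_space edge R).
Variable mu : probability space R.
Hypothesis mu_exp : exponential_product mu.
Variables (n r : nat) (K : nat -> nat).
Local Notation weight := (weight mu).
Local Notation cyl := (cylinder_time weight n K).
Local Notation mincyl := (min_cylinder_time weight n r K).

(** The event at level [x] is the preimage, under rescaling the strip, of the event at level
    [x / (1 + eps)]. *)
Lemma prob_cylinder_time_le (eps x : R) N j : (0 < j)%N -> 0 <= eps ->
  (mu [set f : space | (cyl j f <= x)%R] <=
   (truncation R)%:E * mu [set f : space | (cyl j f <= x / (1 + eps))%R] +
   (truncation R ^- N * ((1 + eps) ^+ N.+1 / (1 + N.+1%:R * eps))
      ^+ (2 * n.+1 * K j))%:E)%E.
Proof.
move=> j0 eps0; have c0 : 0 < 1 + eps by rewrite ltr_pwDl.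
have := prob_scale_le mu_exp N eps0 (truncation_gt0 R) (uniq_strip n K j)
  (measurable_cylinder_time_le mu n K j (x / (1 + eps))).
rewrite size_strip; apply: le_trans; rewrite le_eqVlt; apply/orP; left; apply/eqP.
congr (mu _); apply/seteqP; split => f /=;
  rewrite (@cylinder_time_scale _ mu n K (1 + eps) j f (scale_coords _ _ f))//;
  rewrite ?ler_pM2r ?invr_gt0//.
all: by move=> e ej; rewrite /scale_coords mem_strip// ej.
Qed.

Lemma prob_cylinder_times_gt (y : R) k :
  mu [set f : space | forall j, (1 <= j <= k)%N -> y < cyl j f] =
  (\prod_(1 <= j < k.+1) mu [set f : space | (y < cyl j f)%R])%E.
Proof.
pose A k := [set f : space | forall j, (1 <= j <= k)%N -> y < cyl j f].
pose B j := [set f : space | y < cyl j f].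
have AS k' : A k'.+1 = A k' `&` B k'.+1.
  apply/seteqP; split => f /=.
    by move=> Af; split => [j jk|]; apply: Af; lia.
  move=> [Af Bf] j /andP[j1]; rewrite leq_eqVlt => /orP[/eqP -> //|jk].
  by apply: Af; rewrite j1.
have A0 : A 0%N = setT.
  by apply/seteqP; split => // f _ j; lia.
have mB j : measurable (B j) by exact: measurable_cylinder_time_lt.
have mA k' : measurable (A k').
  elim: k' => [|k' ih]; first by rewrite A0.
  by rewrite AS; apply: measurableI => //; exact: mB.
rewrite -[LHS]/(mu (A k)); elim: k => [|k ih].
  by rewrite big_geq// A0; exact: probability_setT.
rewrite big_nat_recr//= -ih AS.
(* The first [k] cylinders only see edges based strictly below the bottom of cylinder [k.+1]. *)
apply: (prob_independent mu_exp
  (D := [pred e : edge | e.1.2 < (strip_bottom K k.+1)%:Z])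
  (D' := [pred e : edge | in_cylinder n K k.+1 e.1])).
- move=> e /=; apply/negP => /andP[].
  rewrite !inE /= /in_cylinder -/(strip_bottom K k.+1); lia.
- exact: mA.
- exact: mB.
- move=> f g fg Af j jk; rewrite (@cylinder_time_eq _ mu n K j f g)//; first exact: Af.
  case=> [[u v] b] ej; rewrite fg// inE /=; move: ej => /=.
  rewrite /in_cylinder -/(strip_bottom K j) -/(strip_bottom K j.+1).
  have : (strip_bottom K j.+1 <= strip_bottom K k.+1)%N.
    rewrite /strip_bottom [leqRHS](@big_cat_nat _ _ _ j.+1)//=; last by lia.
    exact: leq_addr.
  by move=> h /and3P[_ _ /le_lt_trans]; apply; lia.
- move=> f g fg; rewrite /B /= (@cylinder_time_eq _ mu n K k.+1 f g)//.
  by move=> e ej; rewrite fg.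
Qed.

Hypotheses (n0 : (0 < n)%N) (r0 : (0 < r)%N).

Lemma measurable_mincyl_le x : measurable [set f : space | mincyl f <= x].
Proof.
rewrite (_ : [set _ | _] = mincyl @^-1` `]-oo, x]).
  by rewrite -[X in measurable X]setTI; exact: measurable_min_cylinder_time.
by apply/seteqP; split => f /=; rewrite in_itv.
Qed.

Lemma prob_min_cylinder_time_le (eps x : R) : 0 <= eps ->
  (forall j, (1 <= j <= r)%N ->
    eps ^+ 2 * (n%:R * (K j)%:R * (1 + ln r%:R)) <= 1) ->
  ((1 / 2)%:E <= mu [set f : space | (mincyl f <= x)%R])%E ->
  ((1 - expR (- (3 / 8 / truncation R)))%:E <=
     mu [set f : space | (mincyl f <= x / (1 + eps))%R])%E.
Proof.
move=> eps0 epsK; set y := x / (1 + eps) => Fx.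
pose p j := fine (mu [set f : space | cyl j f <= x]).
pose a j := fine (mu [set f : space | cyl j f <= y]).
have pE j : (p j)%:E = mu [set f : space | cyl j f <= x].
  by rewrite fineK// fin_num_measure//; exact: measurable_cylinder_time_le.
have aE j : (a j)%:E = mu [set f : space | cyl j f <= y].
  by rewrite fineK// fin_num_measure//; exact: measurable_cylinder_time_le.
have t0 := truncation_gt0 R.
have pa j : (1 <= j <= r)%N -> p j <= truncation R * a j + (8 * r%:R)^-1.
  move=> jr; have [N HN] := truncation_le n0 r0 eps0 (epsK j jr).
  have j0 : (0 < j)%N by case/andP: jr.
  have := prob_cylinder_time_le x N j0 eps0; rewrite -pE -aE -EFinM -EFinD lee_fin.
  by move=> /le_trans; apply; rewrite lerD2l.
have sp : 1 / 2 <= \sum_(1 <= j < r.+1) p j.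
  rewrite -lee_fin; apply: le_trans Fx _; rewrite -sumEFin.
  have := measure_bigsetU_le mu (index_iota 1 r.+1)
    (fun j => measurable_cylinder_time_le mu n K j x).
  rewrite (eq_bigr _ (fun j _ => pE j)); apply: le_trans.
  apply: le_measure; rewrite ?inE.
  - exact: measurable_mincyl_le.
  - by apply: bigsetU_measurable => j _; exact: measurable_cylinder_time_le.
  move=> f /=; rewrite /min_cylinder_time.
  have [j jr ->] := min_upto_attained (fun j => cyl j f) r0 => cjx.
  by rewrite -bigcup_seq; exists j => //=; rewrite mem_index_iota ltnS.
(* [1 / 2] from the union bound, minus [r] errors of size [1 / (8 r)]. *)
have sa : 3 / 8 / truncation R <= \sum_(1 <= j < r.+1) a j.
  rewrite ler_pdivrMr// [leRHS]mulrC mulr_sumr.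
  have : \sum_(1 <= j < r.+1) p j <=
      \sum_(1 <= j < r.+1) (truncation R * a j + (8 * r%:R)^-1).
    by rewrite !big_nat; apply: ler_sum => j; rewrite ltnS; exact: pa.
  have E : (8 * r%:R)^-1 *+ r = 1 / 8 :> R.
    by rewrite -[LHS]mulr_natr invfM mulfVK ?div1r// pnatr_eq0 -lt0n.
  by rewrite big_split/= sumr_const_nat subn1/= E; lra.
have gtE : [set f : space | forall j, (1 <= j <= r)%N -> (y < cyl j f)%R] =
    ~` [set f : space | mincyl f <= y].
  apply/seteqP; split => f /=.
    move=> /(lt_min_upto (fun j => cyl j f) r0) fy.
    by apply/negP; rewrite -ltNge.
  move/negP; rewrite -ltNge.
  by move=> /(lt_min_upto (fun j => cyl j f) r0).
have mA := measurable_mincyl_le y.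
rewrite -[X in (_ <= mu X)%E]setCK probability_setC -?gtE; last first.
  by rewrite gtE; exact: measurableC.
rewrite prob_cylinder_times_gt EFinB; apply: leeB => //.
have aC j : mu [set f : space | y < cyl j f] = (1 - a j)%:E.
  rewrite EFinB aE -probability_setC; last exact: measurable_cylinder_time_le.
  by congr (mu _); apply/seteqP; split => f /=; rewrite ltNge; move/negP.
rewrite (eq_bigr _ (fun j _ => aC j)) prodEFin lee_fin.
apply: (@le_trans _ _ (\prod_(1 <= j < r.+1) expR (- a j))).
  apply: ler_prod => j _; rewrite expR_ge1Dx andbT subr_ge0.
  by rewrite -lee_fin aE probability_le1//; exact: measurable_cylinder_time_le.
rewrite -expR_sum ler_expR sumrN lerN2; exact: sa.
Qed.

End fluctuations.

(** * Approximate medians *)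

Section median.
Context d (T : measurableType d) (R : realType) (P : probability T R).
Variable X : {RV P >-> R}.

Let measurable_le x : measurable [set w | X w <= x].
Proof.
rewrite (_ : [set _ | _] = X @^-1` `]-oo, x]); first exact: measurable_funPTI.
by apply/seteqP; split => w /=; rewrite in_itv.
Qed.

(** [m] is the infimum of the levels where the distribution function reaches 1/2. The tolerance [e]
    replaces one-sided continuity: some such level lies below [m + e], and [m - e] is not one. The
    bound at [l] keeps all of them above [l]. *)
Lemma near_median (l e : R) : 0 < e ->
  (P [set w | (X w < l)%R] <= (1 / 4)%:E)%E ->
  exists m, [/\ l <= m, ((1 / 2)%:E <= P [set w | (X w <= m + e)%R])%E &
                ((1 / 2)%:E < P [set w | (m - e <= X w)%R])%E].
Proof.
move=> e0 Pl.
pose S := [set x | ((1 / 2)%:E <= P [set w | (X w <= x)%R])%E].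
have Sl x : S x -> l <= x.
  move=> Sx; rewrite leNgt; apply/negP => xl.
  have : ((1 / 2)%:E <= (1 / 4)%:E :> \bar R)%E.
    apply: le_trans Sx (le_trans _ Pl); apply: le_measure; rewrite ?inE//.
      rewrite (_ : [set _ | _] = X @^-1` `]-oo, l[); first exact: measurable_funPTI.
      by apply/seteqP; split => w /=; rewrite in_itv.
    by move=> w /= /le_lt_trans; exact.
  by rewrite lee_fin; lra.
have S0 : S !=set0.
  have : fine (cdf X x) @[x --> +oo] --> (1 : R) by exact/fine_cvg/cvg_cdfy1.
  move=> /cvgr_ge /(_ (1 / 2)) [|M [_ HM]]; first by lra.
  exists (M + 1); rewrite /S/=.
  have : 1 / 2 <= fine (cdf X (M + 1)) by apply: HM; rewrite ltrDl.
  have <- : cdf X (M + 1) = P [set w | X w <= M + 1].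
    by rewrite /cdf/= /distribution/= /pushforward/=; congr (P _).
  by rewrite -lee_fin fineK ?fin_num_measure.
have Sb : has_inf S by split => //; exists l => x; exact: Sl.
exists (inf S); split.
- by apply: lb_le_inf => // x; exact: Sl.
- have [x Sx xi] := inf_adherent e0 Sb.
  apply: le_trans Sx _; apply: le_measure; rewrite ?inE//.
  by move=> w /= wx; exact: le_trans wx (ltW xi).
- have : ~ S (inf S - e).
    by move=> /(ge_inf (proj2 Sb)); lra.
  move=> /negP; rewrite -ltNge => Plt.
  have mlt : measurable [set w | inf S - e < X w].
    rewrite (_ : [set _ | _] = X @^-1` `]inf S - e, +oo[); first exact: measurable_funPTI.
    by apply/seteqP; split => w /=; rewrite in_itv/= andbT.
  apply: (@lt_le_trans _ _ (P [set w | inf S - e < X w])); last first.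
    apply: le_measure; rewrite ?inE//; last by move=> w /ltW.
    rewrite (_ : [set _ | _] = X @^-1` `[inf S - e, +oo[); first exact: measurable_funPTI.
    by apply/seteqP; split => w /=; rewrite in_itv/= andbT.
  rewrite (_ : [set w | _ < _] = ~` [set w | X w <= inf S - e]); last first.
    by apply/seteqP; split => w /=; rewrite ltNge => /negP.
  rewrite probability_setC//; move: Plt.
  have /fineK <- : P [set w | X w <= inf S - e] \is a fin_num.
    exact: fin_num_measure.
  by rewrite -EFinB !lte_fin; lra.
Qed.

End median.

(** * Transfer from the given weights to their joint law *)

Section iid_weights.
Context d (T : measurableType d) (R : realType) (P : probability T R).
Variable t : edge -> {RV P >-> R}.
Hypothesis t_iid : iid_exponential_mean1 t.

Definition configuration (w : T) : coord_space edge R := fun e => t e w.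

Lemma measurable_configuration : measurable_fun setT configuration.
Proof. by apply: measurable_to_coord_space => e; exact: measurable_funPT. Qed.

HB.instance Definition _ :=
  isMeasurableFun.Build _ _ _ _ configuration measurable_configuration.

Lemma exponential_product_distribution :
  exponential_product (distribution P configuration).
Proof.
move=> s B us mB sB; have [t_exp t_ind] := t_iid.
rewrite /distribution /pushforward.
rewrite (_ : _ @^-1` _ = \big[setI/setT]_(e <- s) (t e @^-1` B e)).
  by rewrite t_ind//; apply: eq_bigr => e _; rewrite -(t_exp e).
rewrite -bigcap_seq; apply/seteqP; split => [w Bw e _|w Bw e]; first exact: Bw.
by have [/Bw//|/sB ->] := boolP (e \in s).
Qed.

End iid_weights.

Theorem proposition3p2 (R : realType) (d : measure_display)
  (T : measurableType d) (P : probability T R)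
  (t : edge -> {RV P >-> R}) (t_iid : iid_exponential_mean1 t)
  (r : nat -> nat) (K : nat -> nat -> nat)
  (r_ge1 : forall n, (1 <= n)%N -> (1 <= r n)%N)
  (K_bounds : forall n j, (1 <= n)%N -> (1 <= j <= r n)%N ->
     (1 <= K n j <= n)%N)
  (K_sum : forall n, (1 <= n)%N -> (\sum_(1 <= j < (r n).+1) K n j)%N = n)
  (K_cvg : (fun n : nat => n%:R `^ (- 2^-1) *
              \sum_(1 <= j < (r n).+1) (K n j)%:R `^ (- 2^-1) : R)
           @ \oo --> (0 : R)) :
  fluctuations_at_least
    (fun n => min_cylinder_time t n (r n) (K n) : {RV P >-> R})
    (fun n => min_upto (r n) (fun j =>
       Num.sqrt (n%:R / ((K n j)%:R * (1 + ln (r n)%:R))))).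
Proof.
pose mu := distribution P (configuration t).
have mu_exp : exponential_product mu := exponential_product_distribution t_iid.
set f : nat -> R := fun n => min_upto _ _.
pose kappa : R := 3 / 8 / truncation R.
have kappa0 : 0 < kappa by rewrite divr_gt0 ?truncation_gt0//; lra.
have ek : expR (- kappa) < 1 by rewrite expR_lt1 oppr_lt0.
(* [1 / 252] is the gap constant, from [l eps / 4] with [l = n / 63]; the other term is half of the
   lower-tail bound, so that the inequality is strict. *)
pose c : R := Num.min (1 / 252) ((1 - expR (- kappa)) / 2).
have c0 : 0 < c by rewrite lt_min; apply/andP; split; lra.
suff H n : (0 < n)%N -> exists ab : R * R,
    [/\ c * f n <= ab.2 - ab.1,
      (c%:E < P [set w | (min_cylinder_time t n (r n) (K n) w <= ab.1)%R])%E &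
      (c%:E < P [set w | (ab.2 <= min_cylinder_time t n (r n) (K n) w)%R])%E].
  have /choice[ab abP] : forall n, exists ab : R * R, (0 < n)%N ->
    [/\ c * f n <= ab.2 - ab.1,
      (c%:E < P [set w | (min_cylinder_time t n (r n) (K n) w <= ab.1)%R])%E &
      (c%:E < P [set w | (ab.2 <= min_cylinder_time t n (r n) (K n) w)%R])%E].
    move=> n; have [n0|n0] := posnP n; first by exists (0, 0); rewrite n0.
    by have [ab abP] := H n n0; exists ab.
  exists (fun n => (ab n).1), (fun n => (ab n).2), c; split => //.
  by exists 1%N => // n /= n0; exact: abP.
move=> n0; have rn0 := r_ge1 n n0.
have Kpos j : (1 <= j <= r n)%N -> (0 < K n j)%N.
  by move=> jr; case/andP: (K_bounds n j n0 jr).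
have nR : 1 <= n%:R :> R by rewrite ler1n.
have lr0 : 0 <= ln ((r n)%:R : R) by rewrite ln_ge0// ler1n.
have den0 j : (1 <= j <= r n)%N -> 1 <= (K n j)%:R * (1 + ln (r n)%:R) :> R.
  by move=> /Kpos K0; rewrite mulr_ege1 ?ler1n// lerDl.
have [j0 j0r fE] := min_upto_attained
  (fun j => Num.sqrt (n%:R / ((K n j)%:R * (1 + ln (r n)%:R : R)))) rn0.
have f0 : 0 < f n.
  rewrite /f fE sqrtr_gt0 divr_gt0//; first by lra.
  by have := den0 _ j0r; lra.
have fK j : (1 <= j <= r n)%N ->
    f n ^+ 2 * ((K n j)%:R * (1 + ln (r n)%:R)) <= n%:R.
  move=> jr; have dj := den0 j jr; rewrite -ler_pdivlMr; last by lra.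
  rewrite -[leRHS]sqr_sqrtr; last by rewrite divr_ge0//; lra.
  rewrite lerXn2r ?nnegrE ?sqrtr_ge0//; first exact: ltW.
  exact: (min_upto_le (fun j =>
    Num.sqrt (n%:R / ((K n j)%:R * (1 + ln (r n)%:R : R)))) jr).
(* The largest value for which the constraint of [truncation_le] holds in all cylinders at once;
   hence the minimum over [j] in the order of fluctuations. *)
pose eps := f n / n%:R.
have eps0 : 0 < eps by rewrite divr_gt0//; lra.
have nE : n%:R * eps = f n by rewrite mulrC divfK// gt_eqF//; lra.
have epsK j : (1 <= j <= r n)%N ->
    eps ^+ 2 * (n%:R * (K n j)%:R * (1 + ln (r n)%:R)) <= 1.
  move=> /fK fKj; rewrite -(ler_pM2l (x := n%:R)); last by lra.
  rewrite mulr1; apply: le_trans fKj; rewrite -nE le_eqVlt; apply/orP; left.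
  by apply/eqP; ring.
have eps1 : eps <= 1.
  have := epsK _ j0r; have := den0 _ j0r; rewrite -mulrA.
  set k := (K n j0)%:R * _ => k1 h.
  suff : eps ^+ 2 <= 1 by nra.
  by apply: le_trans h; rewrite ler_peMr ?sqr_ge0// mulr_ege1.
have Kn : strip_bottom (K n) (r n).+1 = n by exact: K_sum.
pose X : {RV mu >-> R} := min_cylinder_time (weight mu) n (r n) (K n).
pose l : R := n%:R / 63.
have l0 : 0 < l by rewrite divr_gt0//; lra.
have Xl : (mu [set w | (X w < l)%R] <= (1 / 4)%:E)%E.
  exact: prob_min_cylinder_time_lt.
(* As [m >= l] and [eps <= 1], passing from [m] to [m / (1 + eps)] gains at least [l eps / 2]. The
   two tolerances cost at most [2 e = l eps / 4], so half of the gain remains. *)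
have e0 : 0 < l * eps / 8 by apply: divr_gt0; [exact: mulr_gt0|lra].
have [m [lm Xm mX]] := near_median e0 Xl.
set e := l * eps / 8 in e0 Xm mX.
exists ((m + e) / (1 + eps), m - e) => /=; split.
- have c1 : c <= 1 / 252 by rewrite ge_min lexx.
  have le_m : (m + e) / (1 + eps) <= m - e - l * eps / 4.
    rewrite ler_pdivrMr; last by lra.
    have h1 : l * eps <= m * eps by rewrite ler_wpM2r// ltW.
    have h2 : l * eps * eps <= l * eps by rewrite ler_piMr// mulr_ge0// ltW.
    have h3 : 0 <= l * eps by rewrite mulr_ge0// ltW.
    by rewrite /e; lra.
  apply: (@le_trans _ _ (1 / 252 * f n)); first by rewrite ler_wpM2r// ltW.
  have : l * eps = f n / 63 by rewrite /l mulrAC nE.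
  by lra.
- have := prob_min_cylinder_time_le mu_exp n0 rn0 (ltW eps0) epsK Xm.
  apply: lt_le_trans; rewrite lte_fin.
  apply: (@le_lt_trans _ _ ((1 - expR (- kappa)) / 2)); last by lra.
  by rewrite ge_min lexx orbT.
- apply: lt_trans mX; rewrite lte_fin.
  apply: (@le_lt_trans _ _ (1 / 252)); [by rewrite ge_min lexx|lra].
Qed.
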